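(* Suppose that $Y\to X\to X/Y$ is a short exact sequence of Banach spaces that locally splits, and that $Y^{***}$ and $X$ both have the approximation property. Then the pair $(X,Y)$ has the approximation property and hence $X/Y$ has the approximation property.
   Context: $L(X)$ is the space of bounded linear operators on the Banach space $X$, and $\tau$ is the topology on $L(X)$ of uniform convergence on compact subsets of $X$. Subspaces are closed. A Banach space $X$ has the approximation property (AP) if the identity on $X$ is the $\tau$-limit of a net of finite rank bounded linear operators on $X$. For a subspace $Y$ of $X$, the pair $(X,Y)$ has the approximation property (AP) if the identity on $X$ is the $\tau$-limit of a net of finite rank bounded linear operators on $X$ all of which leave $Y$ invariant. A sequence $Y\to X\to Z$ of Banach spaces is a short exact sequence when the operator $Y\to X$ is an isomorphic embedding and the operator $X\to Z$ is surjective and has (the image of) $Y$ as its kernel. Up to passing to equivalent norms, this just says that $Y$ is a subspace of $X$ and $Z$ is the quotient space $X/Y$; $Y$ is regarded as a subspace of $X$ via the embedding. A short exact sequence $Y\to X\to Z$ locally splits if the dual short exact sequence $Z^*\to X^*\to Y^*$ splits, which means that $Z^*$ (identified with its image in $X^*$, i.e. the annihilator $Y^\perp$ of $Y$) is a complemented subspace of $X^*$. $Y^{***}$ is the third dual of $Y$. *)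

(* Defs.v *)
From HB Require Import structures.
From mathcomp Require Import all_boot all_order all_algebra.
From mathcomp Require Import all_classical all_reals all_analysis.
From mathcomp Require Import complex.

Set Implicit Arguments.
Unset Strict Implicit.
Unset Printing Implicit Defensive.

Import Order.TTheory GRing.Theory Num.Theory.
Import numFieldNormedType.Exports.

Local Open Scope classical_set_scope.
Local Open Scope ring_scope.

(* Norms over a numFieldType K take their values in K itself, so an operator
   norm needs suprema of sets of nonnegative elements of K.  The order of R[i]
   compares only numbers with the same imaginary part, so that its nonnegative
   elements are the nonnegative reals and the axiom below holds there too. *)
HB.mixin Record NumField_isNnegComplete K of Num.NumField K := {
  nneg_supremums_neq0 : forall A : set K, A !=set0 ->
    (forall a, A a -> 0 <= a) -> ubound A !=set0 -> supremums A !=set0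
}.

#[short(type="nnegCompleteFieldType")]
HB.structure Definition NnegCompleteField :=
  {K of Num.NumField K & NumField_isNnegComplete K}.

Lemma real_nneg_supremums_neq0 (R : realType) (A : set R) : A !=set0 ->
  (forall a, A a -> 0 <= a) -> ubound A !=set0 -> supremums A !=set0.
Proof.
move=> A0 _ ubA; exists (sup A); split; first exact: sup_upper_bound.
by move=> y yA; apply: ge_sup.
Qed.

Lemma complex_nneg_supremums_neq0 (R : realType) (A : set R[i]) :
  A !=set0 -> (forall a, A a -> 0 <= a) -> ubound A !=set0 ->
  supremums A !=set0.
Proof.
move=> [a0 Aa0] Age0 [u uA].
have AR a : A a -> a = (complex.Re a)%:C%C.
  by move=> /Age0; rewrite lecE /= => /andP[/eqP]; case: a => x y /= ->.
pose B := (@complex.Re R) @` A.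
have B0 : B !=set0 by exists (complex.Re a0), a0.
have ubB : ubound B !=set0.
  exists (complex.Re u) => _ [a Aa <-].
  by have := uA _ Aa; rewrite lecE => /andP[].
have [s [sB sle]] : supremums B !=set0.
  apply: real_nneg_supremums_neq0 => // _ [a /Age0 + <-].
  by rewrite lecE => /andP[].
exists (s%:C)%C; split=> [a Aa|v vA].
  by rewrite (AR _ Aa) lecR; apply: sB; exists a.
have := vA _ Aa0; rewrite (AR _ Aa0) lecE /= => /andP[/eqP v0 _].
rewrite lecE /= v0 eqxx /=; apply: sle => _ [a Aa <-].
by have := vA _ Aa; rewrite lecE => /andP[].
Qed.

Variant scalar_kind := real_scalars | complex_scalars.

Definition scalar_field (R : realType) (k : scalar_kind) :
    nnegCompleteFieldType :=
  match k with
  | real_scalars => HB.pack_for nnegCompleteFieldType (Real.sort R)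
      (NumField_isNnegComplete.Build R (@real_nneg_supremums_neq0 R))
  | complex_scalars => HB.pack_for nnegCompleteFieldType (complex R)
      (NumField_isNnegComplete.Build R[i] (@complex_nneg_supremums_neq0 R))
  end.

Section bounded_operators.
Context {K : nnegCompleteFieldType}.

Definition bounded_linear {V W : normedModType K} : {pred V -> W} :=
  [pred f | `[< linear f /\ exists M, forall x, `|f x| <= M * `|x| >]].

Record bounded_op (V W : normedModType K) := BoundedOp {
  bounded_op_fun :> V -> W;
  bounded_opP : bounded_op_fun \in bounded_linear }.

Section normed_space.
Context {V W : normedModType K}.

HB.instance Definition _ := [isSub of bounded_op V W for @bounded_op_fun V W].
HB.instance Definition _ := [Choice of bounded_op V W by <:].

Lemma bounded_op_linear (f : bounded_op V W) : linear f.
Proof. by have := bounded_opP f; rewrite inE => -[]. Qed.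

HB.instance Definition _ (f : bounded_op V W) :=
  GRing.isLinear.Build K V W *:%R f (bounded_op_linear f).

Lemma bounded_linear_submod_closed :
  submod_closed (@bounded_linear V W : {pred V -> W}).
Proof.
split=> [|a f g].
  rewrite inE; split=> [b x y|]; first by rewrite /= scaler0 addr0.
  by exists 0 => x; rewrite /= normr0 mul0r.
rewrite !inE => -[lf [M fM]] [lg [N gN]]; split=> [b x y|].
  have E z : (a *: f + g) z = a *: f z + g z by [].
  by rewrite !E lf lg !scalerDr !scalerA (mulrC a b) addrACA.
exists (`|a| * M + N) => x; rewrite (le_trans (ler_normD _ _))//.
by rewrite mulrDl lerD// normrZ -mulrA ler_wpM2l.
Qed.

HB.instance Definition _ := GRing.isSubmodClosed.Build K (V -> W)
  (@bounded_linear V W) bounded_linear_submod_closed.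

HB.instance Definition _ := [SubChoice_isSubLmodule of bounded_op V W by <:].

Definition op_norm (f : bounded_op V W) : K :=
  supremum 0 [set `|f x| | x in [set x : V | `|x| <= 1]].

Lemma op_norm_supremums (f : bounded_op V W) :
  supremums [set `|f x| | x in [set x : V | `|x| <= 1]] (op_norm f).
Proof.
set A := (X in supremums X).
have A0 : A !=set0 by exists `|f 0|, 0 => //=; rewrite normr0.
have : supremums A !=set0.
  apply: nneg_supremums_neq0 => //; first by move=> _ [x _ <-].
  have := bounded_opP f; rewrite inE => -[_ [M fM]].
  exists `|M| => _ [x /= x1 <-].
  have [->|x0] := eqVneq x 0; first by rewrite linear0 normr0.
  have nx0 : 0 < `|x| by rewrite normr_gt0.
  have M0 : 0 <= M by rewrite -(pmulr_lge0 _ nx0) (le_trans _ (fM x)).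
  by rewrite (le_trans (fM x))// ger0_norm// ler_piMr.
move=> [s sA]; rewrite /op_norm /supremum.
case: eqP => [A00|_]; last by apply: xgetPex; exists s.
by case: A0 => x Ax; have : set0 x by rewrite -A00.
Qed.

Lemma op_norm_ge0 (f : bounded_op V W) : 0 <= op_norm f.
Proof.
apply: le_trans ((op_norm_supremums f).1 `|f 0| _) => //.
by exists 0 => //=; rewrite normr0.
Qed.

Lemma ler_op_norm (f : bounded_op V W) x : `|f x| <= op_norm f * `|x|.
Proof.
have [->|x0] := eqVneq x 0; first by rewrite linear0 !normr0 mulr0.
have nx0 : 0 < `|x| by rewrite normr_gt0.
rewrite -ler_pdivrMr// mulrC -[`|x|^-1]ger0_norm ?invr_ge0// -normrZ -linearZ.
apply: (op_norm_supremums f).1; exists (`|x|^-1 *: x) => //=.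
by rewrite normrZ ger0_norm ?invr_ge0// mulVf// gt_eqF.
Qed.

Lemma op_norm_le (f : bounded_op V W) (M : K) : 0 <= M ->
  (forall x, `|f x| <= M * `|x|) -> op_norm f <= M.
Proof.
move=> M0 fM; apply: (op_norm_supremums f).2 => _ [x /= x1 <-].
by rewrite (le_trans (fM x))// ler_piMr.
Qed.

Let op_normD (f g : bounded_op V W) : op_norm (f + g) <= op_norm f + op_norm g.
Proof.
apply: op_norm_le => [|x]; first by rewrite addr_ge0 ?op_norm_ge0.
by rewrite (le_trans (ler_normD _ _))// mulrDl lerD// ler_op_norm.
Qed.

Let op_normZ_le (a : K) (f : bounded_op V W) :
  op_norm (a *: f) <= `|a| * op_norm f.
Proof.
apply: op_norm_le => [|x]; first by rewrite mulr_ge0 ?op_norm_ge0.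
by rewrite [leLHS]normrZ -mulrA ler_wpM2l// ler_op_norm.
Qed.

Let op_normZ (a : K) (f : bounded_op V W) :
  op_norm (a *: f) = `|a| * op_norm f.
Proof.
apply/eqP; rewrite eq_le op_normZ_le /=.
have [->|a0] := eqVneq a 0; first by rewrite normr0 mul0r op_norm_ge0.
have := op_normZ_le a^-1 (a *: f).
by rewrite scalerA mulVf// scale1r normfV mulrC ler_pdivlMr ?normr_gt0// mulrC.
Qed.

Let op_norm0_eq0 (f : bounded_op V W) : op_norm f = 0 -> f = 0.
Proof.
move=> f0; apply: val_inj; apply/funext => x /=; apply/eqP.
by rewrite -normr_le0 (le_trans (ler_op_norm f x))// f0 mul0r.
Qed.

HB.instance Definition _ := Lmodule_isNormed.Build K (bounded_op V W)
  op_normD op_normZ op_norm0_eq0.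

End normed_space.

Definition dual (V : normedModType K) : normedModType K := bounded_op V K^o.

Lemma comp_bounded_linear (U V W : normedModType K)
  (g : bounded_op V W) (f : bounded_op U V) : g \o f \in bounded_linear.
Proof.
rewrite inE; split=> [a x y|]; first by rewrite /= !linearP.
exists (op_norm g * op_norm f) => x /=.
rewrite (le_trans (ler_op_norm g _))// -mulrA.
by rewrite ler_wpM2l ?op_norm_ge0// ler_op_norm.
Qed.

Definition comp_op (U V W : normedModType K)
    (g : bounded_op V W) (f : bounded_op U V) : bounded_op U W :=
  BoundedOp (comp_bounded_linear g f).

Lemma adjoint_bounded_linear (V W : normedModType K) (f : bounded_op V W) :
  (fun phi : dual W => comp_op phi f : dual V) \in bounded_linear.
Proof.
rewrite inE; split=> [a phi psi|]; first exact: val_inj.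
exists (op_norm f) => phi; apply: op_norm_le => [|x /=].
  by rewrite mulr_ge0 ?op_norm_ge0.
rewrite (le_trans (ler_op_norm phi _))// [leRHS]mulrAC [leRHS]mulrC.
by rewrite ler_wpM2l ?op_norm_ge0// ler_op_norm.
Qed.

Definition adjoint (V W : normedModType K) (f : bounded_op V W) :
    bounded_op (dual W) (dual V) :=
  BoundedOp (adjoint_bounded_linear f).

Definition finite_rank (V W : normedModType K) (f : bounded_op V W) :=
  exists (n : nat) (w : 'I_n -> W),
    forall x, exists c : 'I_n -> K, f x = \sum_(i < n) c i *: w i.

Definition isomorphic_embedding (V W : normedModType K) (f : bounded_op V W) :=
  exists2 c : K, 0 < c & forall x, c * `|x| <= `|f x|.

Definition surjective_op (V W : normedModType K) (f : bounded_op V W) :=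
  range f = [set: W].

Definition short_exact (Y X Z : normedModType K)
    (i : bounded_op Y X) (q : bounded_op X Z) :=
  [/\ isomorphic_embedding i, surjective_op q & [set x | q x = 0] = range i].

Definition complemented (V : normedModType K) (A : set V) :=
  exists P : bounded_op V V, (forall x, P (P x) = P x) /\ range P = A.

(* For a short exact sequence with quotient map q: [range (adjoint q)] is the
   copy of Z^* inside X^*. *)
Definition locally_splits (X Z : normedModType K) (q : bounded_op X Z) :=
  complemented (range (adjoint q)).

End bounded_operators.

Record directed (I : Type) (le : I -> I -> Prop) : Prop := Directed {
  directed_inhabited : inhabited I;
  directed_refl : forall i, le i i;
  directed_trans : forall i j k, le i j -> le j k -> le i k;
  directed_ub : forall i j, exists k, le i k /\ le j k }.

Definition net_tails (I : Type) (le : I -> I -> Prop) : set_system I :=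
  filter_from [set: I] (fun i => [set j | le i j]).

Section approximation_property.
Context {K : nnegCompleteFieldType}.

Definition id_is_tau_limit (X : normedModType K) (S : set (bounded_op X X)) :=
  exists (I : Type) (le : I -> I -> Prop) (T : I -> bounded_op X X),
    [/\ directed le, forall i, S (T i) &
        {family compact,
          (fun i => T i : X -> X) @ net_tails le --> (id : X -> X)}].

Definition approximation_property (X : normedModType K) :=
  id_is_tau_limit [set T : bounded_op X X | finite_rank T].

(* The closed subspace Y of X is given as a subset of X. *)
Definition pair_approximation_property (X : normedModType K) (Y : set X) :=
  id_is_tau_limit
    [set T : bounded_op X X | finite_rank T /\ T @` Y `<=` Y].

End approximation_property.

(* Main.v *)
From HB Require Import structures.
Require Import Defs.
From mathcomp Require Import all_boot all_order all_algebra.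
From mathcomp Require Import all_classical all_reals all_analysis.
From mathcomp Require Import complex ring.

Set Implicit Arguments.
Unset Strict Implicit.
Unset Printing Implicit Defensive.

Import Order.TTheory GRing.Theory Num.Theory.
Import numFieldNormedType.Exports.

Local Open Scope classical_set_scope.
Local Open Scope ring_scope.

(* A functional on L(X) that is continuous for uniform convergence on compact
   sets has the form T |-> sum_n f_n (T x_n) with sum_n |f_n| finite and x_n
   tending to 0, so by Hahn-Banach it suffices to show that such a functional
   annihilates the identity when it annihilates the finite rank operators that
   leave Y invariant.  The nuclear operator u = sum_n f_n (x) x_n then vanishes
   on Y and maps X into Y.  Let P be the projection of X^* onto Z^*.  Since u^*
   maps X^* into Z^*, the operators u and sum_n P f_n (x) x_n coincide, and have
   the same trace because X has the AP.  Writing P f_n = a_n o q, the operator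
   v = sum_n a_n (x) x_n from Z to X takes its values in Y.  The splitting
   provides H : X -> Y^** that extends the canonical embedding of Y, so that v
   is nuclear as an operator into Y^**.  As Y^*** has the AP, v is nuclear as an
   operator into Y (Oja and Reinov): v = sum_j b_j (x) y_j with b_j in Z^* and
   y_j in Y.  Since X has the AP, the trace of sum_n a_n (x) x_n equals
   sum_j b_j (q y_j) = 0. *)

(** * Hahn-Banach separation *)

(** The obstacle is that the x_n need not lie in Y: although v maps into Y, the terms a_n (q x_n) do
    not vanish one by one. A representation of v with vectors of Y removes it, because q vanishes on
    each of them. Traces of two representations of one operator agree only under an approximation
    property, which is called upon at two places for X and at one for Y^***. The third dual appears
    by duality: a functional on tensors of Z^* with Y^** is an operator B from Z^* to Y^***, whereas
    tensors of Z^* with Y see only the component of B in Y^*. The other component annihilates Y, and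
    v has its values there, so this component contributes a representation of the zero operator.
    Approximation by finite tensors divides the remainder by 4 each time; the factor 4^-j is then
    shared as 2^-j on the coefficients and 2^-j on the vectors, which makes the new trace continuous
    for uniform convergence on compact sets. *)

Section sublinear_functionals.
Context {R : realType} {V : lmodType R}.

Definition sublinear (p : V -> R) :=
  (forall x y, p (x + y) <= p x + p y) /\
  (forall t x, 0 <= t -> p (t *: x) = t * p x).

Lemma sublinear0 p : sublinear p -> p 0 = 0.
Proof. by move=> [_ /(_ 0 0)]; rewrite scale0r mul0r; apply. Qed.

Lemma sublinearN p x : sublinear p -> - p (- x) <= p x.
Proof.
move=> sp; rewrite -subr_ge0 opprK addrC.
by rewrite (le_trans _ (sp.1 _ _))// addNr sublinear0.
Qed.

(* The largest sublinear functional [r] below [p] such that [r (- y) <= - p y].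
   If [p] is minimal then [r = p], whence additivity of [p]. *)
Definition ray_inf (p : V -> R) (y x : V) : R :=
  inf [set p (x + t *: y) - t * p y | t in [set t | 0 <= t]].

Section ray_inf.
Variables (p : V -> R) (y : V).
Hypothesis sp : sublinear p.

Let ray_lb x : lbound
  [set p (x + t *: y) - t * p y | t in [set t | 0 <= t]] (- p (- x)).
Proof.
move=> _ [t t0 <-]; rewrite lerBrDl lerBlDr -(sp.2 _ _ t0).
by rewrite (le_trans _ (sp.1 _ _))// addrAC subrr add0r.
Qed.

Lemma ray_inf_le x t : 0 <= t -> ray_inf p y x <= p (x + t *: y) - t * p y.
Proof.
move=> t0; apply: ge_inf; first by exists (- p (- x)); exact: ray_lb.
by exists t.
Qed.

Lemma ge_ray_inf x c : (forall t, 0 <= t -> c <= p (x + t *: y) - t * p y) ->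
  c <= ray_inf p y x.
Proof.
move=> H; apply: lb_le_inf; first by exists (p (x + 0 *: y) - 0 * p y), 0 => /=.
by move=> _ [t t0 <-]; exact: H.
Qed.

Lemma ray_inf_ler x : ray_inf p y x <= p x.
Proof.
by rewrite (le_trans (ray_inf_le x (lexx 0)))// scale0r addr0 mul0r subr0.
Qed.

Lemma ray_infN : ray_inf p y (- y) <= - p y.
Proof.
rewrite (le_trans (ray_inf_le _ ler01))// scale1r addNr mul1r.
by rewrite sublinear0// sub0r.
Qed.

Lemma ray_inf_sublinear : sublinear (ray_inf p y).
Proof.
have subadd x1 x2 : ray_inf p y (x1 + x2) <= ray_inf p y x1 + ray_inf p y x2.
  rewrite -lerBlDr; apply: ge_ray_inf => t1 t10.
  rewrite lerBlDr -lerBlDl; apply: ge_ray_inf => t2 t20.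
  rewrite lerBlDl; apply: (le_trans (ray_inf_le _ (addr_ge0 t10 t20))).
  rewrite scalerDl addrACA mulrDl opprD.
  by rewrite [leRHS]addrACA lerD2r sp.1.
(* This inequality for every [t > 0], applied to [t^-1], also gives the reverse one. *)
have homle t x : 0 < t -> t * ray_inf p y x <= ray_inf p y (t *: x).
  move=> t0; apply: ge_ray_inf => s s0.
  rewrite mulrC -ler_pdivlMr//.
  apply: (le_trans (ray_inf_le x (_ : 0 <= s / t))).
    by rewrite divr_ge0// ltW.
  rewrite ler_pdivlMr// mulrBl mulrC -(sp.2 _ _ (ltW t0)) scalerDr scalerA.
  by rewrite mulrCA divff ?gt_eqF// mulr1 mulrAC divfK ?gt_eqF.
split => // t x; rewrite le_eqVlt => /predU1P[<-|t0].
  rewrite scale0r mul0r; apply/eqP; rewrite eq_le; apply/andP; split.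
    by rewrite -(sublinear0 sp) ray_inf_ler.
  by apply: ge_ray_inf => s s0; rewrite add0r (sp.2 _ _ s0) subrr.
apply/eqP; rewrite eq_le homle// andbT.
rewrite mulrC -ler_pdivrMr// mulrC.
by rewrite (le_trans (homle _ _ _)) ?invr_gt0// scalerA mulVf ?scale1r ?gt_eqF.
Qed.

End ray_inf.

Lemma minimal_sublinear_linear p : sublinear p ->
    (forall q, sublinear q -> (forall x, q x <= p x) -> forall x, p x <= q x) ->
  linear p.
Proof.
move=> sp minp.
have add x y : p (x + y) = p x + p y.
  apply/eqP; rewrite eq_le sp.1 /= -lerBrDr.
  have /(_ x) := minp _ (ray_inf_sublinear y sp) (ray_inf_ler y sp).
  move=> /le_trans; apply.
  by rewrite (le_trans (ray_inf_le _ _ _ (ler01)))// scale1r mul1r.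
have opp x : p (- x) = - p x.
  by apply/eqP; rewrite -addr_eq0 -add addNr sublinear0.
move=> a x y; rewrite add; congr (_ + _).
have [a0|a0] := leP 0 a; first exact: sp.2.
have := sp.2 (- a) x; rewrite oppr_ge0 scaleNr opp mulNr => /(_ (ltW a0)).
exact: oppr_inj.
Qed.

(** A minimal sublinear functional is linear, so Zorn's lemma is applied to sublinear functionals
    instead of extensions from subspaces. Starting below [ray_inf p x0] gives [f (- x0) <= - p x0],
    which forces equality at [x0]. *)
Theorem hahn_banach p x0 : sublinear p ->
  exists f : V -> R, [/\ linear f, forall x, f x <= p x & f x0 = p x0].
Proof.
move=> sp; set p0 := ray_inf p x0.
have sp0 : sublinear p0 by exact: ray_inf_sublinear.
pose T := {q : V -> R | sublinear q /\ forall x, q x <= p0 x}.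
(* The order is reversed: a maximal element is a minimal functional, and a chain is bounded by its
   pointwise infimum. *)
pose le (q1 q2 : T) := `[< forall x, sval q2 x <= sval q1 x >].
have [|||[f [sf fp0]] fmin] := @ZL_preorder T (exist _ p0 (conj sp0 (fun=>
  lexx _))) le.
- by move=> q; apply/asboolP.
- move=> q1 q2 q3 /asboolP le12 /asboolP le23; apply/asboolP => x.
  exact: le_trans (le23 x) (le12 x).
- move=> A totA; have [[q0 Aq0]|A0] := pselect (A !=set0); last first.
    by exists (exist _ p0 (conj sp0 (fun=> lexx _))) => q Aq; case: A0;
      exists q.
  pose g x := inf [set sval q x | q in A].
  have lb x q : A q -> - p0 (- x) <= sval q x.
    case: q => q [sq qp0] _ /=; rewrite (le_trans _ (sublinearN x sq))//.
    by rewrite lerN2.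
  have gle x q : A q -> g x <= sval q x.
    move=> Aq; apply: ge_inf; last by exists q.
    by exists (- p0 (- x)) => _ [r Ar <-]; exact: lb.
  have geg x c : (forall q, A q -> c <= sval q x) -> c <= g x.
    move=> H; apply: lb_le_inf; first by exists (sval q0 x), q0.
    by move=> _ [q Aq <-]; exact: H.
  (* An infimum of sublinear functionals need not be subadditive; in a chain the smaller of [q1] and
     [q2] serves for both arguments. *)
  have sg : sublinear g.
    split=> [x y|t x].
      rewrite -lerBlDr; apply: (geg) => q1 Aq1.
      rewrite lerBlDr -lerBlDl; apply: geg => q2 Aq2.
      rewrite lerBlDl.
      have /orP[/asboolP le12|/asboolP le21] : le q1 q2 || le q2 q1.
        by apply/orP; exact: totA.
      + rewrite (le_trans (gle _ _ Aq2))// (le_trans ((svalP q2).1.1 _ _))//.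
        by rewrite lerD2r.
      + rewrite (le_trans (gle _ _ Aq1))// (le_trans ((svalP q1).1.1 _ _))//.
        by rewrite lerD2l.
    rewrite le_eqVlt => /predU1P[<-|t0].
      rewrite scale0r mul0r; apply/eqP; rewrite eq_le; apply/andP; split.
        by rewrite -(sublinear0 (svalP q0).1) gle.
      by apply: geg => q Aq; rewrite (sublinear0 (svalP q).1).
    apply/eqP; rewrite eq_le; apply/andP; split.
      rewrite mulrC -ler_pdivrMr//; apply: geg => q Aq.
      rewrite ler_pdivrMr// mulrC -((svalP q).1.2 _ _ (ltW t0)).
      exact: gle.
    apply: geg => q Aq; rewrite ((svalP q).1.2 _ _ (ltW t0)) ler_pM2l//.
    exact: gle.
  have gp0 x : g x <= p0 x by rewrite (le_trans (gle _ _ Aq0))// (svalP q0).2.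
  by exists (exist _ g (conj sg gp0)) => q Aq; apply/asboolP => x; exact: gle.
have lf : linear f.
  apply: minimal_sublinear_linear => // q sq qf x.
  have qp0 y : q y <= p0 y by rewrite (le_trans (qf y)).
  by have /asboolP := fmin (exist _ q (conj sq qp0)) (asboolT qf); apply.
have fp x : f x <= p x by rewrite (le_trans (fp0 x))// ray_inf_ler.
exists f; split => //; apply/eqP; rewrite eq_le fp /=.
have fN : f (- x0) = - f x0.
  apply/eqP; rewrite -addr_eq0 -[X in X + _]mul1r.
  by rewrite -[1 * _]/(1 *: f (- x0) : R^o) -lf scale1r addNr (sublinear0 sf).
by rewrite -lerN2 -fN (le_trans (fp0 _))// ray_infN.
Qed.

End sublinear_functionals.

(** * Separation of a point from an absolutely convex absorbing set *)

Definition absolutely_convex (K : numFieldType) (V : lmodType K) (C : set V) :=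
  forall a b x y, C x -> C y -> `|a| + `|b| <= 1 -> C (a *: x + b *: y).

Definition absorbing (K : numFieldType) (V : lmodType K) (C : set V) :=
  forall x, exists2 r, 0 < r & C (r *: x).

Lemma absolutely_convexZ (K : numFieldType) (V : lmodType K) (C : set V) a x :
  absolutely_convex C -> C x -> `|a| <= 1 -> C (a *: x).
Proof.
move=> cC Cx a1; have := cC a 0 x x Cx Cx.
by rewrite normr0 addr0 scale0r addr0; apply.
Qed.

(** [p] is the Minkowski gauge of [C]. It is at most 1 on [C] and at least 1 at [t], since [r < 1]
    with [r^-1 *: t] in [C] would put [t] in [C]; Hahn-Banach at [t] does the rest. *)
Lemma real_separation (R : realType) (V : lmodType R) (C : set V) (t : V) :
  absolutely_convex C -> absorbing C -> ~ C t ->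
  exists f : V -> R, [/\ linear f, 1 <= f t & forall x, C x -> f x <= 1].
Proof.
move=> cC aC nCt; pose S x := [set r : R | 0 < r /\ C (r^-1 *: x)].
have S0 x : S x !=set0.
  by have [r r0 Cr] := aC x; exists r^-1; rewrite /S /= invr_gt0 invrK.
have Slb x : has_lbound (S x) by exists 0 => r [/ltW].
pose p x := inf (S x).
have ple x r : S x r -> p x <= r by exact: ge_inf.
have pge x c : lbound (S x) c -> c <= p x by exact: lb_le_inf.
have SZ a x r : 0 < a -> S x r -> S (a *: x) (a * r).
  move=> a0 [r0 Cr]; split; first exact: mulr_gt0.
  by rewrite scalerA invfM mulrAC mulVf ?gt_eqF// mul1r.
have homle a x : 0 < a -> p (a *: x) <= a * p x.
  move=> a0; rewrite mulrC -ler_pdivrMr//; apply: pge => r Sr.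
  by rewrite ler_pdivrMr// mulrC; apply: ple; exact: SZ.
have sp : sublinear p.
  split=> [x y|a x].
    rewrite -lerBlDr; apply: (pge) => r1 [r10 Cr1].
    rewrite lerBlDr -lerBlDl; apply: (pge) => r2 [r20 Cr2].
    rewrite lerBlDl; apply: ple; have r120 := addr_gt0 r10 r20; split => //.
    have := cC (r1 / (r1 + r2)) (r2 / (r1 + r2)) _ _ Cr1 Cr2.
    rewrite !scalerA (mulrAC r1) (mulrAC r2) !divff ?gt_eqF// !mul1r -scalerDr.
    apply; rewrite !gtr0_norm ?divr_gt0//.
    by rewrite -mulrDl divff ?gt_eqF//.
  rewrite le_eqVlt => /predU1P[<-|a0].
    rewrite scale0r mul0r; apply/eqP; rewrite eq_le; apply/andP; split.
      apply/ler_addgt0Pr => e e0; rewrite add0r; apply: ple; split => //.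
      by have [r _] := aC 0; rewrite !scaler0.
    by apply: pge => r [/ltW].
  apply/eqP; rewrite eq_le homle//= mulrC -ler_pdivlMr// mulrC.
  by rewrite (le_trans _ (homle _ _ _)) ?invr_gt0// scalerA mulVf ?scale1r//
    gt_eqF.
have [f [lf fp ft]] := hahn_banach t sp.
exists f; split => //.
  rewrite ft; apply: pge => r [r0 Cr]; rewrite leNgt; apply/negP => r1.
  apply: nCt; rewrite -[t](scale1r) -(divff (lt0r_neq0 r0)) -scalerA.
  by apply: absolutely_convexZ => //; rewrite gtr0_norm// ltW.
move=> x Cx; apply: (le_trans (fp x)); apply: ple; split => //.
by rewrite invr1 scale1r.
Qed.

Section realification.
Context {R : realType} (V : lmodType R[i]).
Local Open Scope complex_scope.

Definition realification : Type := V.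
HB.instance Definition _ := GRing.Zmodule.on realification.

Let scale (a : R) (x : realification) : realification := a%:C *: (x : V).

Let scaleA a b x : scale a (scale b x) = scale (a * b) x.
Proof. by rewrite /scale scalerA -rmorphM. Qed.

Let scale1 : left_id 1 scale.
Proof. by move=> x; rewrite /scale scale1r. Qed.

Let scaleDr : right_distributive scale +%R.
Proof. by move=> a x y; rewrite /scale scalerDr. Qed.

Let scaleDl x : {morph scale^~ x : a b / a + b}.
Proof. by move=> a b; rewrite /scale rmorphD scalerDl. Qed.

HB.instance Definition _ :=
  GRing.Zmodule_isLmodule.Build R realification scaleA scale1 scaleDr scaleDl.

Lemma realification_scaleE a (x : realification) : a *: x = a%:C *: (x : V).
Proof. by []. Qed.

End realification.

Lemma complex_separation (R : realType) (V : lmodType R[i]) (C : set V) (t :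
  V) :
  absolutely_convex C -> absorbing C -> ~ C t ->
  exists phi : V -> R[i]^o,
    [/\ linear phi, phi t != 0, 1 <= `|phi t| & forall x, C x -> `|phi x| <= 1].
Proof.
move=> cC aC nCt.
have cCR : absolutely_convex (C : set (realification V)).
  move=> a b x y Cx Cy ab; apply: cC => //.
  by rewrite !normc_def /= !expr0n /= !addr0 !sqrtr_sqr -rmorphD lecR.
have aCR : absorbing (C : set (realification V)).
  move=> x; have [r r0 Cr] := aC x; have rE : r = (complex.Re r)%:C%C.
    by move: r0; rewrite ltcE /= => /andP[/eqP i0 _]; case: (r) i0 => u v /= ->.
  exists (complex.Re r); first by rewrite -ltcR -rE.
  by rewrite realification_scaleE -rE.
have [f [lf ft fC]] := real_separation cCR aCR nCt.
have fD (x y : V) : f (x + y) = f x + f y.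
  by have := lf 1 x y; rewrite !scale1r.
have f0 : f 0 = 0 by apply: (addrI (f 0)); rewrite -fD !addr0.
have fZ (a : R) (x : V) : f (a%:C%C *: x) = a * f x.
  by have := lf a x 0; rewrite !addr0 f0 addr0.
have fN (x : V) : f (- x) = - f x.
  by apply/eqP; rewrite -addr_eq0 -fD addNr f0.
(* The complex linear functional with real part [f] (Bohnenblust-Sobczyk). *)
pose phi (x : V) : R[i]^o := Complex (f x) (- f ('i%C *: x)).
have lphi : linear phi.
  move=> a x y; rewrite /phi; case: a => a b.
  have iE (z : V) : f (Complex a b *: z) = a * f z + b * f ('i%C *: z).
    have -> : Complex a b = a%:C%C + b%:C%C * 'i%C by simpc.
    by rewrite scalerDl fD -scalerA !fZ.
  have ii (z : V) : f ('i%C *: ('i%C *: z)) = - f z.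
    by rewrite scalerA -expr2 sqr_i scaleN1r fN.
  have iC c (z : V) : 'i%C *: (c *: z) = c *: ('i%C *: z).
    by rewrite !scalerA mulrC.
  apply/eqP; rewrite eq_complex /= !scalerDr !fD iC !iE !ii.
  by apply/andP; split; apply/eqP; ring.
have norm_phi (x : V) : `|f x| <= complex.Re `|phi x|.
  rewrite normc_def /= -[leLHS](sqrtr_sqr) ler_wsqrtr// lerDl sqr_ge0 //.
exists phi; split => //.
- apply: contraTneq ft => /(congr1 (@complex.Re R)) /= ->.
  by rewrite -ltNge ltr01.
- by rewrite lecE /= eqxx /= (le_trans ft)// (le_trans (ler_norm _))//.
move=> x Cx; have [->|phi0] := eqVneq (phi x) 0; first by rewrite normr0 ler01.
(* Rotation by the unimodular [u] makes the value of [phi] real and nonnegative, so the bound on its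
   real part [f] bounds the modulus. *)
pose u := `|phi x| / phi x.
have u1 : `|u| = 1 by rewrite normrM normfV normr_id divff ?normr_eq0.
have : C (u *: x) by apply: absolutely_convexZ => //; rewrite u1.
move=> /fC; rewrite -[f _]/(complex.Re (phi (u *: x))).
have -> : phi (u *: x) = `|phi x|.
  have phi00 : phi 0 = 0.
    by have := lphi (-1) 0 0; rewrite scaler0 addr0 scaleN1r addNr.
  by have := lphi u x 0; rewrite !addr0 phi00 addr0 => ->; exact: divfK.
by rewrite normc_def /= => H; rewrite lecE /= eqxx.
Qed.

Theorem scalar_field_separation (R : realType) (k : scalar_kind)
    (V : lmodType (scalar_field R k)) (C : set V) (t : V) :
  absolutely_convex C -> absorbing C -> ~ C t ->
  exists phi : V -> (scalar_field R k)^o,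
    [/\ linear phi, phi t = 1 & forall x, C x -> `|phi x| <= 1].
Proof.
move=> cC aC nCt.
suff [phi [lphi phit0 phit phiC]] : exists phi : V -> (scalar_field R k)^o,
    [/\ linear phi, phi t != 0, 1 <= `|phi t| & forall x, C x -> `|phi x| <= 1].
  exists (fun x => (phi t)^-1 * phi x); split.
  - by move=> a x y; rewrite lphi mulrDr [X in X + _]mulrCA.
  - exact: mulVf.
  - move=> x Cx; rewrite normrM normfV mulrC ler_pdivrMr ?normr_gt0// mul1r.
    exact: le_trans (phiC x Cx) phit.
case: k V C t cC aC nCt => V C t cC aC nCt; last exact: complex_separation.
have [f [lf ft fC]] := @real_separation R V C t cC aC nCt.
have ft0 : 0 < f t by rewrite (lt_le_trans _ ft).
exists f; split => //; first exact: lt0r_neq0.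
  by rewrite ger0_norm// ltW.
move=> x Cx; have f0 : f 0 = 0.
  by apply: (addrI (1 *: (f 0 : R^o))); rewrite -lf scaler0 !addr0 [RHS]mul1r.
have fN : f (- x) = - f x.
  by have := lf (-1) x 0; rewrite f0 !addr0 scaleN1r => ->; rewrite scaleN1r.
have CN : C (- x).
  by rewrite -scaleN1r; apply: absolutely_convexZ => //; rewrite normrN1.
by rewrite [`|_| <= 1]ler_norml lerNl -fN !fC.
Qed.

(** * Sequences and duals *)

Section sequences.
Context {K : nnegCompleteFieldType}.
Implicit Types V W : normedModType K.

Lemma cvg_seqP V (u : nat -> V) (l : V) : u @ \oo --> l <->
  forall e : K, 0 < e -> exists N, forall n, (N <= n)%N -> `|u n - l| <= e.
Proof.
split=> [/cvgrPdist_le H e e0|H].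
  by have [N _ HN] := H e e0; exists N => n Nn; rewrite distrC; exact: HN.
apply/cvgrPdist_le => e e0; have [N HN] := H e e0.
by exists N => // n Nn; rewrite distrC; exact: HN.
Qed.

Lemma cvg_seq_unique V (u : nat -> V) (l m : V) :
  u @ \oo --> l -> u @ \oo --> m -> l = m.
Proof. exact: (cvg_unique (@norm_hausdorff _ V)). Qed.

(** Completeness implies the archimedean property: a supremum [s] of the natural numbers would
    satisfy [s <= s - 1]. *)
Lemma archimedean_inv (e : K) : 0 < e -> exists n, n.+1%:R^-1 <= e.
Proof.
move=> e0; apply: contrapT => nH.
pose A : set K := range (fun n : nat => n%:R).
have ub n : n.+1%:R <= e^-1.
  have := nH; rewrite -forallNE => /(_ n) /negP.
  rewrite -real_ltNge ?gtr0_real ?invr_gt0 ?ltr0n// => H.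
  by rewrite -[leLHS]invrK lef_pV2 ?posrE ?invr_gt0// ltW.
have [s [sub slub]] : supremums A !=set0.
  apply: nneg_supremums_neq0; first by exists 0, 0%N.
    by move=> _ [n _ <-].
  by exists e^-1 => _ [n _ <-]; rewrite (le_trans _ (ub n))// ler_nat.
have : s <= s - 1.
  by apply: slub => _ [n _ <-]; rewrite lerBrDr natr1; apply: sub; exists n.+1.
by rewrite lerBrDr gerDl ler10.
Qed.

Lemma cvg_half : (fun n => 2^-1 ^+ n : K^o) @ \oo --> (0 : K^o).
Proof.
apply/cvg_seqP => e e0; have [N HN] := archimedean_inv e0; exists N => n Nn.
rewrite subr0 normrX normfV normr_nat (le_trans _ HN)// exprVn.
rewrite lef_pV2 ?posrE ?exprn_gt0 ?ltr0n// -natrX ler_nat.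
by rewrite (leq_trans _ (ltn_expl n _)).
Qed.

Lemma norm_cvg_le V (u : nat -> V) (l : V) (c : K) :
  u @ \oo --> l -> (exists N, forall n, (N <= n)%N -> `|u n| <= c) -> `|l| <= c.
Proof.
move=> /cvg_seqP ul [N uc]; apply/ler_addgt0Pr => e e0.
have [M HM] := ul e e0; have := HM _ (leq_maxl M N).
have := uc _ (leq_maxr M N); set x := u _ => xc xe.
rewrite -[l](subrK x) addrC (le_trans (ler_normD _ _))// lerD//.
by rewrite distrC.
Qed.

Lemma cvg_bounded_seq V (u : nat -> V) (l : V) :
  u @ \oo --> l -> exists2 c : K, 0 < c & forall n, `|u n| <= c.
Proof.
move=> /cvg_seqP /(_ 1 ltr01)[N HN].
exists (\sum_(k < N) `|u k| + (1 + `|l|)) => [|n].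
  by rewrite ltr_wpDl ?sumr_ge0// ltr_pwDl.
have [nN|Nn] := ltnP n N.
  by rewrite (bigD1 (Ordinal nN))//= -addrA lerDl addr_ge0 ?sumr_ge0// addr_ge0.
rewrite -[leLHS]add0r lerD ?sumr_ge0//.
by rewrite -[u n](subrK l) (le_trans (ler_normD _ _))// lerD// HN.
Qed.

Lemma cvg_bounded_op V W (f : bounded_op V W) (u : nat -> V) (l : V) :
  u @ \oo --> l -> (fun n => f (u n)) @ \oo --> f l.
Proof.
move=> /cvg_seqP ul; apply/cvg_seqP => e e0.
have n0 := op_norm_ge0 f.
have [N HN] := ul (e / (op_norm f + 1)) (divr_gt0 e0 (ltr_wpDl n0 ltr01)).
exists N => n Nn; rewrite -linearB (le_trans (ler_op_norm f _))//.
rewrite (le_trans (ler_wpM2l n0 (HN n Nn)))// mulrCA ler_piMr ?ltW//.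
by rewrite ltr_pdivrMr ?mul1r ?ltrDl// ltr_wpDl.
Qed.

Definition summable_norm V (f : nat -> V) :=
  exists M : K, forall n, \sum_(0 <= k < n) `|f k| <= M.

Lemma summable_norm_ub V (f : nat -> V) : summable_norm f ->
  exists2 M : K, 0 < M & forall n, \sum_(0 <= k < n) `|f k| <= M.
Proof.
move=> [M fM]; have M0 : 0 <= M by have := fM 0%N; rewrite big_geq.
by exists (M + 1) => [|n]; rewrite ?ltr_wpDl// (le_trans (fM n))// lerDl.
Qed.

Lemma summable_normM V W (f : nat -> V) (g : nat -> W) (c : K) :
  0 <= c -> (forall n, `|g n| <= c * `|f n|) -> summable_norm f ->
  summable_norm g.
Proof.
move=> c0 gf [M fM]; exists (c * M) => n.
rewrite (le_trans _ (ler_wpM2l c0 (fM n)))// mulr_sumr ler_sum//.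
Qed.

Definition cauchy_seq V (u : nat -> V) := forall e : K, 0 < e ->
  exists N, forall m n, (N <= m)%N -> (N <= n)%N -> `|u m - u n| <= e.

Definition seq_complete V :=
  forall u : nat -> V, cauchy_seq u -> exists l : V, u @ \oo --> l.

Lemma completeNormedModType_seq_complete (V : completeNormedModType K) :
  seq_complete V.
Proof.
move=> u cu; apply/cvg_ex; apply: cauchy_cvg; apply: cauchy_exP => e e0.
have [N HN] := cu (e / 2) (divr_gt0 e0 (ltr0n _ 2)).
exists (u N), N => // n Nn; rewrite -ball_normE /ball_ /=.
by rewrite (le_lt_trans (HN _ _ _ _))// ltr_pdivrMr// ltr_pMr// ltr1n.
Qed.

(** The axiom on nonnegative scalars gives the supremum [l] of the partial sums of norms; past an
    [N] with [l - e <= s N] every block of norms sums to at most [e]. *)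
Lemma summable_norm_cauchy V (t : nat -> V) :
  summable_norm t -> cauchy_seq (series t).
Proof.
move=> [M tM] e e0; pose s n := \sum_(0 <= k < n) `|t k|.
have [l [sl lM]] : supremums (range s) !=set0.
  apply: nneg_supremums_neq0; first by exists (s 0%N), 0%N.
    by move=> _ [n _ <-]; exact: sumr_ge0.
  by exists M => _ [n _ <-]; exact: tM.
have [N HN] : exists N, l - e <= s N.
  apply: contrapT => nH; have : l <= l - e.
    apply: lM => _ [n _ <-]; apply: contrapT => /negP sn; apply: nH; exists n.
    have ls : s n <= l by apply: sl; exists n.
    have sR : s n \is Num.real by rewrite ger0_real// sumr_ge0.
    have lR : l \is Num.real by rewrite ger0_real// (le_trans _ ls)// sumr_ge0.
    by rewrite ltW// real_ltNge// realB// gtr0_real.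
  by rewrite lerBrDr gerDl lt_geF.
suff H m n : (N <= m)%N -> (m <= n)%N -> `|series t m - series t n| <= e.
  exists N => m n Nm Nn; have [mn|/ltnW nm] := leqP m n; first exact: H.
  by rewrite distrC H.
move=> Nm mn; rewrite distrC sub_series_geq//.
rewrite (le_trans (ler_norm_sum _ _ _))//.
rewrite -(lerD2l (s m)) [leLHS](_ : _ = s n); last first.
  by rewrite /s [RHS](big_cat_nat (leq0n m) mn).
have sn : s n <= l by apply: sl; exists n.
rewrite (le_trans sn)//.
rewrite -lerBlDr (le_trans HN)// /s [leRHS](big_cat_nat (leq0n N) Nm)//= lerDl.
by rewrite sumr_ge0.
Qed.

End sequences.

Lemma scalar_field_seq_complete (R : realType) (k : scalar_kind) :
  seq_complete (scalar_field R k)^o.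
Proof.
have realC (u : nat -> R) :
    (forall e : R, 0 < e -> exists N, forall m n, (N <= m)%N -> (N <= n)%N ->
      `|u m - u n| <= e) ->
    exists l : R, forall e : R, 0 < e -> exists N, forall n, (N <= n)%N ->
      `|u n - l| <= e.
  move=> cu; have : cvgn u.
    apply: cauchy_cvg; apply: cauchy_exP => e e0.
    have [N HN] := cu (e / 2) (divr_gt0 e0 (ltr0n _ 2)).
    exists (u N), N => // n Nn; rewrite -ball_normE /ball_ /=.
    by rewrite (le_lt_trans (HN _ _ _ _))// ltr_pdivrMr// ltr_pMr// ltr1n.
  move=> /cvg_ex[l /cvgrPdist_le H]; exists l => e e0.
  by have [N _ HN] := H e e0; exists N => n Nn; rewrite distrC; exact: HN.
case: k => u cu.
  by have [l ul] := realC u cu; exists l; apply/cvg_seqP => e e0; exact: ul.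
have cplx (e : R[i]) : 0 < e -> e = (complex.Re e)%:C%C /\ 0 < complex.Re e.
  by case: e => a b; rewrite ltcE /= => /andP[/eqP ->].
have normE (z : R[i]) : `|z| = (complex.Re `|z|)%:C%C by [].
have Rele (z : R[i]) : `|complex.Re z| <= complex.Re `|z|.
  case: z => a b; rewrite normc_def /= -[leLHS](sqrtr_sqr) ler_wsqrtr//.
  by rewrite lerDl sqr_ge0.
have Imle (z : R[i]) : `|complex.Im z| <= complex.Re `|z|.
  case: z => a b; rewrite normc_def /= -[leLHS](sqrtr_sqr) ler_wsqrtr//.
  by rewrite lerDr sqr_ge0.
have normle (z : R[i]) : `|z| <= (`|complex.Re z| + `|complex.Im z|)%:C%C.
  case: z => a b; rewrite lecE /= eqxx /=.
  rewrite -[leRHS]ger0_norm ?addr_ge0// -sqrtr_sqr ler_wsqrtr//.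
  by rewrite sqrrD !real_normK ?num_real// -addrA lerD2l lerDr mulrn_wge0//
    mulr_ge0.
have cue (e : R) : 0 < e -> exists N, forall m n, (N <= m)%N -> (N <= n)%N ->
    complex.Re `|(u m - u n : R[i])| <= e.
  move=> e0; have := cu e%:C%C; rewrite ltcR => /(_ e0)[N HN].
  by exists N => m n Nm Nn; have := HN m n Nm Nn; rewrite lecE => /andP[].
have [|a ha] := realC (fun n => complex.Re (u n)).
  move=> e /cue[N HN]; exists N => m n Nm Nn.
  by rewrite -raddfB (le_trans (Rele _))// HN.
have [|b hb] := realC (fun n => complex.Im (u n)).
  move=> e /cue[N HN]; exists N => m n Nm Nn.
  by rewrite -raddfB (le_trans (Imle _))// HN.
exists (Complex a b); apply/cvg_seqP => e /cplx[eE e0].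
have [N HN] := ha _ (divr_gt0 e0 (ltr0n _ 2)).
have [N' HN'] := hb _ (divr_gt0 e0 (ltr0n _ 2)).
exists (maxn N N') => n; rewrite geq_max => /andP[Nn N'n].
rewrite [leLHS]normE [leRHS]eE lecR.
have := normle (u n - Complex a b); rewrite lecE => /andP[_]/le_trans; apply.
by rewrite !raddfB /= [leRHS]splitr lerD ?HN ?HN'.
Qed.

(* Unification unfolds [scalar_field], so the properties of the scalars are used
   through this class. *)
Class banach_scalars (K : nnegCompleteFieldType) : Prop := BanachScalars {
  separation : forall (V : lmodType K) (C : set V) (t : V),
    absolutely_convex C -> absorbing C -> ~ C t ->
    exists phi : V -> K^o,
      [/\ linear phi, phi t = 1 & forall x, C x -> `|phi x| <= 1];
  scalar_seq_complete : seq_complete K^o }.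

#[global] Instance scalar_field_banach_scalars R k :
  banach_scalars (scalar_field R k).
Proof.
split; [exact: scalar_field_separation|exact: scalar_field_seq_complete].
Qed.

(** * Hahn-Banach theorems in normed spaces and operators of finite rank *)

Section bounded_operators.
Context {K : nnegCompleteFieldType} {hK : banach_scalars K}.
Implicit Types V W : normedModType K.

Lemma bounded_linearP V W (f : V -> W) :
  linear f -> (exists M, forall x, `|f x| <= M * `|x|) -> f \in bounded_linear.
Proof. by move=> lf bf; rewrite inE. Qed.

Lemma bounded_op_eq V W (f g : bounded_op V W) : f =1 g -> f = g.
Proof. by move=> fg; apply: val_inj; apply/funext. Qed.

Lemma bounded_opD V W (f : bounded_op V W) x y : f (x + y) = f x + f y.
Proof. exact: linearD. Qed.

Lemma bounded_opB V W (f : bounded_op V W) x y : f (x - y) = f x - f y.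
Proof. exact: linearB. Qed.

Lemma bounded_opZ V W (f : bounded_op V W) a x : f (a *: x) = a *: f x.
Proof. exact: linearZ. Qed.

Lemma bounded_op0 V W (f : bounded_op V W) : f 0 = 0.
Proof. exact: linear0. Qed.

Lemma dualZ V (f : dual V) a x : f (a *: x) = a * f x.
Proof. exact: linearZ. Qed.

Lemma bounded_op_sum V W (I : Type) (r : seq I) (P : pred I)
    (F : I -> bounded_op V W) x :
  (\sum_(i <- r | P i) F i) x = \sum_(i <- r | P i) F i x.
Proof. by elim/big_rec2: _ => //= i y1 y2 _ <-. Qed.

Lemma rank1_bounded_linear V W (f : dual V) (w : W) :
  (fun x => f x *: w) \in (@bounded_linear K V W).
Proof.
apply: bounded_linearP => [a x y|].
  by rewrite linearP scalerDl scalerA.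
exists (op_norm f * `|w|) => x; rewrite normrZ mulrAC ler_wpM2r//.
exact: ler_op_norm.
Qed.

Definition rank1 V W (f : dual V) (w : W) : bounded_op V W :=
  BoundedOp (rank1_bounded_linear f w).

Lemma idmap_bounded_linear V : (idfun : V -> V) \in (@bounded_linear K V V).
Proof. by apply: bounded_linearP => //; exists 1 => x; rewrite mul1r. Qed.

Definition id_op V : bounded_op V V := BoundedOp (idmap_bounded_linear V).

Lemma eval_bounded_linear V (x : V) :
  (fun f : dual V => f x) \in (@bounded_linear K (dual V) K^o).
Proof.
apply: bounded_linearP => [//|]; exists `|x| => f; rewrite mulrC.
exact: ler_op_norm.
Qed.

Definition evaluation V (x : V) : dual (dual V) :=
  BoundedOp (eval_bounded_linear x).

Lemma bidual_bounded_linear V :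
  (@evaluation V) \in (@bounded_linear K V (dual (dual V))).
Proof.
apply: bounded_linearP => [a x y|].
  by apply: bounded_op_eq => f /=; rewrite linearP.
exists 1 => x; rewrite mul1r; apply: op_norm_le => // f /=; rewrite mulrC.
exact: ler_op_norm.
Qed.

Definition bidual V : bounded_op V (dual (dual V)) :=
  BoundedOp (bidual_bounded_linear V).

(** The ball inside [C] serves twice: it makes [C] absorbing, and it bounds the separating
    functional. *)
Lemma normed_separation V (C : set V) (t : V) (r : K) :
  absolutely_convex C -> 0 < r -> (forall x, `|x| <= r -> C x) -> ~ C t ->
  exists f : dual V,
    [/\ f t = 1, op_norm f <= r^-1 & forall x, C x -> `|f x| <= 1].
Proof.
move=> cC r0 rC nCt.
have aC : absorbing C.
  move=> x; have x1 : 0 < `|x| + 1 by rewrite ltr_wpDl.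
  exists (r / (`|x| + 1)); first exact: divr_gt0.
  apply: rC; rewrite normrZ gtr0_norm ?divr_gt0// mulrAC ler_pdivrMr//.
  by rewrite ler_wpM2l ?lerDl// ltW.
have [phi [lphi phit phiC]] := separation cC aC nCt.
have phib x : `|phi x| <= r^-1 * `|x|.
  have [->|x0] := eqVneq x 0.
    have phi0 : phi 0 = 0.
      by have := lphi (-1) 0 0; rewrite scaler0 addr0 scaleN1r addNr.
    by rewrite phi0 !normr0 mulr0.
  have nx0 : 0 < `|x| by rewrite normr_gt0.
  have phiZ a z : phi (a *: z) = a * phi z.
    have phi0 : phi 0 = 0.
      by have := lphi (-1) 0 0; rewrite scaler0 addr0 scaleN1r addNr.
    by have := lphi a z 0; rewrite phi0 !addr0.
  have : `|phi ((r / `|x|) *: x)| <= 1.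
    apply: phiC; apply: rC; rewrite normrZ gtr0_norm ?divr_gt0//.
    by rewrite divfK// gt_eqF.
  rewrite phiZ normrM gtr0_norm ?divr_gt0// -mulrA -ler_pdivlMl// mulr1.
  by rewrite mulrC ler_pdivrMr.
have bphi : phi \in (@bounded_linear K V K^o).
  by apply: bounded_linearP => //; exists r^-1.
exists (BoundedOp bphi); split => //.
by apply: op_norm_le => //; rewrite invr_ge0 ltW.
Qed.

Lemma ball_absolutely_convex V (r : K) :
  absolutely_convex [set x : V | `|x| <= r].
Proof.
move=> a b x y /= xr yr ab; rewrite (le_trans (ler_normD _ _))// !normrZ.
have r0 : 0 <= r by rewrite (le_trans _ xr).
rewrite (le_trans (lerD (ler_wpM2l _ xr) (ler_wpM2l _ yr)))//.
by rewrite -mulrDl ler_piMl.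
Qed.

Lemma dual_separates V (x : V) : x != 0 -> exists f : dual V, f x = 1.
Proof.
move=> x0; have nx0 : 0 < `|x| by rewrite normr_gt0.
have := @normed_separation V [set y | `|y| <= `|x| / 2] x (`|x| / 2).
case=> [|||/=|f [fx _ _]]; last by exists f.
- exact: ball_absolutely_convex.
- exact: divr_gt0.
- by [].
- move/negP; apply; rewrite lt_geF// ltr_pdivrMr// ltr_pMr ?ltr1n//.
Qed.

Lemma dual_eq0 V (x : V) : (forall f : dual V, f x = 0) -> x = 0.
Proof.
move=> fx; apply/eqP; apply: contrapT => /negP /dual_separates[f].
by rewrite fx => /eqP; rewrite eq_sym oner_eq0.
Qed.

Lemma dual_seq_complete V : seq_complete (dual V).
Proof.
move=> u cu.
have cux x : cauchy_seq (fun n => u n x : K^o).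
  move=> e e0; have x1 : 0 < `|x| + 1 by rewrite ltr_wpDl.
  have [N HN] := cu _ (divr_gt0 e0 x1); exists N => m n Nm Nn.
  rewrite (le_trans (ler_op_norm (u m - u n) x))//.
  rewrite (le_trans (ler_wpM2r _ (HN m n Nm Nn)))//.
  by rewrite mulrAC ler_pdivrMr// ler_wpM2l ?lerDl// ltW.
have [g gl] := choice (fun x => scalar_seq_complete (cux x)).
have gle (e : K) N : (forall m n, (N <= m)%N -> (N <= n)%N ->
    `|u m - u n| <= e) -> forall n x, (N <= n)%N -> `|u n x - g x| <= e * `|x|.
  move=> HN n x Nn; apply: (@norm_cvg_le _ _ (fun m => u n x - u m x)).
    by apply: cvgB; [exact: cvg_cst|exact: gl].
  exists N => m Nm; rewrite (le_trans (ler_op_norm (u n - u m) x))//.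
  by rewrite ler_wpM2r// HN.
have bg : g \in (@bounded_linear K V K^o).
  apply: bounded_linearP.
    move=> a x y; apply: (cvg_seq_unique (gl _)).
    rewrite (_ : (fun n => _) = (fun n => a *: (u n x : K^o) + u n y)).
      by apply: cvgD; [apply: cvgZl_tmp|]; exact: gl.
    by apply/funext => n; rewrite linearP.
  have [N HN] := cu 1 ltr01; exists (op_norm (u N) + 1) => x.
  rewrite -[g x](subKr (u N x)) (le_trans (ler_normB _ _))// mulrDl lerD//.
    exact: ler_op_norm.
  exact: gle HN _ _ _.
exists (BoundedOp bg); apply/cvg_seqP => e e0.
have [N HN] := cu e e0; exists N => n Nn.
apply: op_norm_le => [|x]; first exact: ltW.
exact: gle HN _ _ _.
Qed.

(** Applied to functionals bounded by 1 on a set that is stable under all multiples: they vanish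
    there. *)
Lemma bounded_multiples0 (z : K) : (forall a : K, `|a * z| <= 1) -> z = 0.
Proof.
move=> H; apply/eqP; apply: contrapT => /negP z0.
by have := H (2 / z); rewrite divfK// normr_nat lern1.
Qed.

Lemma op_norm0 V W : op_norm (0 : bounded_op V W) = 0.
Proof.
apply/eqP; rewrite eq_le op_norm_ge0 andbT; apply: op_norm_le => // x.
by rewrite mul0r normr0.
Qed.

(** With [f y0 != 0], the point [i y0] is separated by [h] from the image of the kernel of [f]
    fattened by a ball of radius [r]; then [f y0 *: h] extends [f]. If [i y0 = i y + w] with
    [f y = 0] and [|w| <= r], then [|f y0| <= op_norm f * r / c], which the choice of [r] makes
    [|f y0| / 2]. The bound [|f y0| / r] is the source of the constant [2 / c]. *)
Lemma dual_extension V W (i : bounded_op V W) : isomorphic_embedding i ->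
  exists2 c : K, 0 <= c & forall f : dual V, exists g : dual W,
    comp_op g i = f /\ op_norm g <= c * op_norm f.
Proof.
move=> [c c0 ic]; exists (2 / c) => [|f]; first by rewrite divr_ge0// ltW.
have [->|f0] := eqVneq f 0.
  exists 0; split; first by apply: bounded_op_eq => x.
  by rewrite !op_norm0 mulr0.
have [y0 fy0] : exists y, f y != 0.
  apply: contrapT => nH; move/eqP: f0; apply; apply: bounded_op_eq => y.
  by apply: contrapT => /eqP fy; apply: nH; exists y.
have nf0 : 0 < op_norm f.
  rewrite lt_def op_norm_ge0 andbT; apply: contraNneq fy0 => nf0.
  by rewrite -normr_le0 (le_trans (ler_op_norm f y0))// nf0 mul0r.
have nfy0 : 0 < `|f y0| by rewrite normr_gt0.
pose r := c * `|f y0| / (2 * op_norm f).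
have r0 : 0 < r by rewrite !(divr_gt0, mulr_gt0).
pose C := [set z | exists y w, [/\ z = i y + w, f y = 0 & `|w| <= r]].
have cC : absolutely_convex C.
  move=> a b _ _ [y [w [-> fy wr]]] [y' [w' [-> fy' wr']]] ab.
  exists (a *: y + b *: y'), (a *: w + b *: w'); split.
  - by rewrite !scalerDr bounded_opD !bounded_opZ addrACA.
  - by rewrite bounded_opD !dualZ fy fy' !mulr0 addr0.
  - exact: ball_absolutely_convex wr wr' ab.
have nC : ~ C (i y0).
  move=> [y [w [iE fy wr]]]; have := ler_op_norm f (y0 - y).
  rewrite bounded_opB fy subr0 => H1.
  have H2 : op_norm f * `|y0 - y| <= `|f y0| / 2.
    rewrite mulrC -ler_pdivlMr// -(ler_pM2l c0) (le_trans (ic _))//.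
    rewrite bounded_opB iE addrAC subrr add0r (le_trans wr)//.
    by rewrite /r invfM !mulrA.
  have := le_trans H1 H2; apply/negP.
  by rewrite lt_geF// ltr_pdivrMr// ltr_pMr ?ltr1n//.
have [|h [hy0 hr hC]] := normed_separation cC r0 _ nC.
  by move=> w wr; exists 0, w; rewrite !bounded_op0 add0r.
have hker y : f y = 0 -> h (i y) = 0.
  move=> fy; apply: bounded_multiples0 => a.
  rewrite -dualZ -bounded_opZ; apply: hC; exists (a *: y), 0.
  by rewrite addr0 dualZ fy mulr0 normr0 ltW.
exists (f y0 *: h); split.
  apply: bounded_op_eq => y /=.
  have /hker : f (y - (f y / f y0) *: y0) = 0.
    by rewrite bounded_opB dualZ divfK// subrr.
  rewrite bounded_opB bounded_opZ bounded_opB dualZ hy0 mulr1 => /eqP;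
    rewrite subr_eq0 => /eqP hE.
  by rewrite -[LHS]/(f y0 * h (i y)) hE mulrC divfK.
rewrite -[leLHS]/(`|f y0 *: h|) normrZ (le_trans (ler_wpM2l _ hr))//.
suff -> : `|f y0| * r^-1 = 2 / c * op_norm f by [].
by rewrite /r; field; rewrite !gt_eqF.
Qed.

(** In [finite_rank] the coefficients depend on the point in no prescribed way. Induction on the
    number of vectors makes them functionals: if [g] fixes [w ord0] in the sense of [gw], removing
    [rank1 (comp_op g T) (w ord0)] from [T] leaves values in the span of one vector fewer. *)
Lemma finite_rankP V W (T : bounded_op V W) : finite_rank T <->
  exists s : seq (dual V * W), forall x, T x = \sum_(p <- s) p.1 x *: p.2.
Proof.
split=> [|[s Ts]]; last first.
  exists (size s), (fun i => (nth 0 s i).2) => x.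
  by exists (fun i => (nth 0 s i).1 x); rewrite Ts (big_nth 0) big_mkord.
move=> [n [w]]; elim: n => [|n IHn] in T w *.
  by move=> Tw; exists [::] => x; have [c ->] := Tw x; rewrite big_ord0 big_nil.
move=> Tw; have [g gw] : exists g : dual W, g (w ord0) *: w ord0 = w ord0.
  have [->|/dual_separates[g gw]] := eqVneq (w ord0) 0.
    by exists 0; rewrite scaler0.
  by exists g; rewrite gw scale1r.
have [|s Ts] := IHn (T - rank1 (comp_op g T) (w ord0))
    (fun i => w (lift ord0 i) - g (w (lift ord0 i)) *: w ord0).
  move=> x; have [c Tx] := Tw x; exists (fun i => c (lift ord0 i)).
  rewrite -[LHS]/(T x - g (T x) *: w ord0) Tx big_ord_recl bounded_opD.
  rewrite bounded_opZ linear_sum scalerDl -[_ *: g _]/(_ * _) -scalerA gw.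
  rewrite opprD addrACA subrr add0r scaler_suml -sumrB; apply: eq_bigr => i _.
  rewrite scalerBr scalerA; congr (_ - _ *: _); exact: dualZ.
exists ((comp_op g T, w ord0) :: s) => x; rewrite big_cons -Ts.
rewrite -[RHS]/(g (T x) *: w ord0 + (T x - g (T x) *: w ord0)).
by rewrite addrC subrK.
Qed.

Lemma finite_rank_linear V W (a : K) (S T : bounded_op V W) :
  finite_rank S -> finite_rank T -> finite_rank (a *: S + T).
Proof.
move=> /finite_rankP[s Ss] /finite_rankP[t Tt]; apply/finite_rankP.
exists ([seq (a *: p.1, p.2) | p <- s] ++ t) => x.
rewrite big_cat big_map -Tt -[LHS]/(a *: S x + T x) Ss scaler_sumr.
by congr (_ + _); apply: eq_bigr => p _; rewrite scalerA.
Qed.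

Lemma finite_rank_rank1 V W (f : dual V) (w : W) : finite_rank (rank1 f w).
Proof. by apply/finite_rankP; exists [:: (f, w)] => x; rewrite big_seq1. Qed.

End bounded_operators.

(** * The topology of uniform convergence on compact sets *)

Section null_sequences.
Context {K : nnegCompleteFieldType}.
Implicit Types V W : normedModType K.

(** If 0 is not a cluster point of [F], some member of [F] avoids a neighbourhood of 0, so [F]
    contains a finite set of terms, which is compact. *)
Lemma null_sequence_compact V (x : nat -> V) :
  x @ \oo --> 0 -> compact (0 |` range x).
Proof.
move=> x0 F FF FA; have [F0|] := pselect (cluster F 0).
  by exists 0; split => //; left.
rewrite /cluster /= => nF0.
have [B [U [FB U0 BU]]] : exists B U, [/\ F B, nbhs 0 U & B `&` U = set0].
  apply: contrapT => nH; apply: nF0 => B U FB U0; apply/set0P/eqP => BU.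
  by apply: nH; exists B, U.
have [N _ HN] : \forall n \near \oo, U (x n) by exact: x0 U0.
have FD : F (x @` `I_N).
  apply: filterS (filterI FA FB) => y [[->|[n _ <-]] By].
    have : (B `&` U) 0 by split => //; exact: nbhs_singleton.
    by rewrite BU.
  have [nN|Nn] := ltnP n N; first by exists n.
  have : (B `&` U) (x n) by split => //; exact: HN.
  by rewrite BU.
have [y [[n _ <-] Fy]] := finite_compact (finite_image x (finite_II N)) FF FD.
by exists (x n); split => //; right; exists n.
Qed.

Lemma null_sequence_enum V (D : nat -> seq V) :
  (forall e : K, 0 < e -> exists N, forall n d, (N <= n)%N -> d \in D n ->
    `|d| <= e) ->
  exists x : nat -> V, x @ \oo --> 0 /\
    forall n d, d \in D n -> exists m, x m = d.
Proof.
move=> D0; pose g (p : nat * nat) := nth 0 (D p.1) p.2.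
(* Codes of no pair and positions past the end of a list give the harmless value 0. *)
exists (fun m => oapp g 0 (pickle_inv m)); split; last first.
  move=> n d dD; exists (pickle (n, index d (D n))).
  by rewrite pickleK_inv /= /g /= nth_index.
apply/cvg_seqP => e e0; have [N HN] := D0 e e0.
(* This exceeds the code of every entry of the lists [D n] with [n < N], so a later nonzero term
   comes from a list with small entries. *)
exists (\sum_(n < N) \sum_(j < size (D n)) (pickle (nat_of_ord n, nat_of_ord
  j)).+1)%N.
move=> m Mm; rewrite subr0; case E: (pickle_inv m) => [[n j]|] /=; last first.
  by rewrite normr0 ltW.
have mE : pickle (n, j) = m by have := @pickle_invK (nat * nat)%type m;
  rewrite E.
rewrite /g /=; have [jD|Dj] := ltnP j (size (D n)); last first.
  by rewrite nth_default// normr0 ltW.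
have [nN|Nn] := ltnP n N; last by apply: (HN n) => //; exact: mem_nth.
suff : (m < m)%N by rewrite ltnn.
rewrite -{1}mE (leq_trans _ Mm)// (bigD1 (Ordinal nN))//= (bigD1 (Ordinal
  jD))//=.
by rewrite -addnA leq_addr.
Qed.

Lemma compact_net V (A : set V) (e : K) : compact A -> 0 < e ->
  exists s : seq V, forall a, A a -> exists2 p, p \in s & `|a - p| <= e.
Proof.
move=> + e0; rewrite compact_cover => cA.
have [|a Aa|D _ AD] := cA V setT (fun y => (ball y e)°).
- by move=> y _; exact: open_interior.
- by exists a => //; exact: nbhsx_ballx.
exists (finmap.enum_fset D) => a /AD[y yD].
move=> /interior_subset; rewrite -ball_normE /= => /ltW ya.
by exists y => //; rewrite distrC.
Qed.

(* Telescoping along finite [4^-n]-nets writes a point of [A] as a sum of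
   [2^-n x_n], where [x_n] runs through a sequence that tends to 0. *)
Lemma compact_null_hull V (A : set V) : compact A ->
  exists2 x : nat -> V, x @ \oo --> 0 &
    forall W (S : bounded_op V W) (e : K), (forall n, `|S (x n)| <= e) ->
      forall a, A a -> `|S a| <= 2 * e.
Proof.
move=> cA; pose h : K := 2^-1.
have h0 : 0 < h by rewrite invr_gt0.
have [F HF] := choice (fun n => compact_net cA (mulr_gt0 (exprn_gt0 n h0)
  (exprn_gt0 n h0))).
(* Only differences of close net points are kept: norm at most [2 * 4^-m] before scaling by
   [2^(m+1)], hence at most [4 * 2^-m] after it, so the entries tend to 0. *)
pose D n := if n is m.+1 then
  [seq 2 ^+ n *: d | d <- [seq a - b | a <- F n, b <- F m] &
     `|d| <= 2 * (h ^+ m * h ^+ m)] else F 0%N.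
have [|x [x0 xD]] := @null_sequence_enum V D.
  move=> e e0; have /cvg_seqP := @cvg_half K.
  move=> /(_ (e / 4) (divr_gt0 e0 (ltr0n _ 4))) [N HN].
  exists N.+1 => -[//|n] d; rewrite ltnS => Nn /mapP[c + ->].
  rewrite mem_filter => /andP[cn _]; rewrite normrZ normrX normr_nat.
  have := HN n Nn; rewrite subr0 gtr0_norm ?exprn_gt0// -/h => hn.
  rewrite (le_trans (ler_wpM2l _ cn)) ?exprn_ge0//.
  have -> : 2 ^+ n.+1 * (2 * (h ^+ n * h ^+ n)) = h ^+ n * 4; last first.
    by rewrite -ler_pdivlMr ?ltr0n.
  have h1 : 2 ^+ n * h ^+ n = 1 by rewrite -exprMn mulfV ?expr1n.
  by rewrite exprS; transitivity (2 ^+ n * h ^+ n * (h ^+ n * 4));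
    [ring|rewrite h1 mul1r].
exists x => // W S e Se a Aa.
have /choice[p Hp] n : exists p, p \in F n /\ `|a - p| <= h ^+ n * h ^+ n.
  by have [p ? ?] := HF n a Aa; exists p.
have pcvg : p @ \oo --> a.
  apply/cvg_seqP => d d0; have /cvg_seqP/(_ d d0)[N HN] := @cvg_half K.
  exists N => n Nn; rewrite distrC; have [_ /le_trans] := Hp n; apply.
  have := HN n Nn; rewrite subr0 gtr0_norm ?exprn_gt0// -/h => /(le_trans _);
    apply.
  by rewrite ler_piMl ?exprn_ge0 ?exprn_ile1 ?(ltW h0)// invf_le1// ler1n.
have e0 : 0 <= e by rewrite (le_trans _ (Se 0%N)).
(* The factor is the partial sum 1 + 1/2 + ... + 2^-n: each telescoping step from [p n] to [p n.+1]
   costs [2^-(n+1) * e]. *)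
have Sp n : `|S (p n)| <= (2 - h ^+ n) * e.
  elim: n => [|n IHn].
    have [m <-] := xD 0%N (p 0%N) (Hp 0%N).1.
    by rewrite expr0 (_ : 2 - 1 = 1) ?mul1r ?Se//; ring.
  have pD : 2 ^+ n.+1 *: (p n.+1 - p n) \in D n.+1.
    apply/map_f; rewrite mem_filter; apply/andP; split; last first.
      by apply: allpairs_f; [exact: (Hp n.+1).1|exact: (Hp n).1].
    rewrite -(subrKA a) (le_trans (ler_normD _ _))// distrC mulr_natl mulr2n.
    rewrite lerD ?(Hp n).2//.
    rewrite (le_trans (Hp n.+1).2)// exprS mulrACA ler_piMl ?mulr_ge0
      ?exprn_ge0//.
    + exact: ltW.
    + exact: ltW.
    + by rewrite mulr_ile1 ?(ltW h0)// invf_le1// ler1n.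
  have [m xm] := xD _ _ pD; have := Se m.
  rewrite xm bounded_opZ bounded_opB normrZ normrX normr_nat => Sm.
  rewrite -[S _](subrK (S (p n))) (le_trans (ler_normD _ _))//.
  rewrite (_ : (2 - h ^+ n.+1) * e = h ^+ n.+1 * e + (2 - h ^+ n) * e).
    rewrite lerD// exprVn mulrC ler_pdivlMr ?exprn_gt0// mulrC//.
  by rewrite exprS; set g := h ^+ n; rewrite /h; field.
apply: (@norm_cvg_le _ _ (fun n => S (p n))); first exact: cvg_bounded_op.
exists 0%N => n _.
by rewrite (le_trans (Sp n))// ler_wpM2r// gerBl exprn_ge0// ltW.
Qed.

(** By [compact_null_hull], uniform control on null sequences amounts to control on compact sets, so
    that nets and compact sets can be left behind. *)
Definition approximates_id V (S : set (bounded_op V V)) :=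
  forall x : nat -> V, x @ \oo --> 0 -> forall e : K, 0 < e ->
    exists2 T, S T & forall n, `|T (x n) - x n| <= e.

Lemma approximates_id_on_compact V (S : set (bounded_op V V)) (A : set V) (e :
  K) :
  approximates_id S -> compact A -> 0 < e ->
  exists2 T, S T & forall a, A a -> `|T a - a| <= e.
Proof.
move=> Sid cA e0; have [x x0 xA] := compact_null_hull cA.
have [T ST Tx] := Sid x x0 _ (divr_gt0 e0 (ltr0n _ 2)).
exists T => // a /(xA _ (T - id_op V) (e / 2) Tx).
by rewrite mulrC divfK.
Qed.

Lemma net_tails_filter (I : Type) (le : I -> I -> Prop) :
  directed le -> ProperFilter (net_tails le).
Proof.
move=> [[i0] refl trans ub]; apply: filter_from_proper; last first.
  by move=> i _; exists i; exact: refl.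
apply: filter_from_filter; first by exists i0.
move=> i j _ _; have [l [il jl]] := ub i j; exists l => // m lm.
by split; apply: trans lm.
Qed.

Theorem id_is_tau_limitP V (S : set (bounded_op V V)) :
  id_is_tau_limit S <-> approximates_id S.
Proof.
split=> [[I [le [T [dir ST Tid]]]] x x0 e e0|Sid].
  have FF := net_tails_filter dir.
  move: Tid => /fam_cvgP /(_ _ (null_sequence_compact x0)) Tid.
  pose P := [set h : V -> V | forall y, (0 |` range x) y -> ball y e (h y)].
  have [i _ HP] : net_tails le [set i | P (T i)].
    apply: (Tid P); apply/uniform_nbhs.
    exists [set xy | ball xy.1 e xy.2]; split; last by move=> h.
    by rewrite -entourage_ballE; exists e.
  exists (T i) => // n; have := HP i (directed_refl dir i) (x n).
  rewrite -ball_normE /= distrC => H; apply/ltW/H; right; by exists n.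
pose I := ({A : set V | compact A} * nat)%type.
pose le (i j : I) := sval i.1 `<=` sval j.1 /\ (i.2 <= j.2)%N.
have H (i : I) : exists T, S T /\ forall a, sval i.1 a -> `|T a - a| <=
  i.2.+1%:R^-1.
  have [|T ST Ta] := approximates_id_on_compact Sid (svalP i.1) (_ :
    0 < i.2.+1%:R^-1).
    by rewrite invr_gt0.
  by exists T.
have [T HT] := choice H.
have dir : directed le.
  split.
  - by constructor; exact: (exist _ _ (@compact0 V), 0%N).
  - by move=> i; split.
  - by move=> i j l [ij ij'] [jl jl']; split;
      [apply: subset_trans jl|exact: leq_trans jl'].
  - move=> [[A cA] n] [[B cB] m].
    exists (exist _ _ (compactU cA cB), maxn n m); split; split => //=.
    + exact: leq_maxl.
    + exact: leq_maxr.
have FF := net_tails_filter dir.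
exists I, le, T; split => //; first by move=> i; exact: (HT i).1.
apply/fam_cvgP => A cA P /uniform_nbhs[E [/= entE EP]].
move: entE; rewrite -entourage_ballE => -[e /= e0 eE].
have [n ne] := archimedean_inv (divr_gt0 e0 (ltr0n _ 2)).
exists (exist _ A cA, n) => // -[[B cB] m] [/= AB nm]; apply: EP => y Ay.
apply: eE; rewrite /= -ball_normE /= distrC.
rewrite (le_lt_trans ((HT (exist _ B cB, m)).2 y (AB _ Ay)))//=.
rewrite (@le_lt_trans _ _ n.+1%:R^-1)//.
  by rewrite lef_pV2 ?posrE// ler_nat.
by rewrite (le_lt_trans ne)// ltr_pdivrMr// ltr_pMr// ltr1n.
Qed.

End null_sequences.

Section null_sequence_space.
Context {K : nnegCompleteFieldType} (V : normedModType K).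

Definition null_sequence : {pred nat -> V} := [pred x | `[< x @ \oo --> 0 >]].

(** A bare vector space: in the separation argument an absorbing set containing a sup norm ball
    takes the place of a norm. *)
Record c0 := C0 {
  c0_fun :> nat -> V;
  c0P : c0_fun \in null_sequence }.

HB.instance Definition _ := [isSub of c0 for c0_fun].
HB.instance Definition _ := [Choice of c0 by <:].

Lemma null_sequence_submod_closed : submod_closed null_sequence.
Proof.
split=> [|a x y]; first by apply/asboolP; exact: cvg_cst.
move=> /asboolP x0 /asboolP y0; apply/asboolP.
rewrite -[0](addr0 (0 : V)) -[X in nbhs (X + _)](scaler0 V a).
by apply: cvgD => //; exact: cvgZl_tmp.
Qed.

HB.instance Definition _ := GRing.isSubmodClosed.Build K (nat -> V)
  null_sequence null_sequence_submod_closed.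

HB.instance Definition _ := [SubChoice_isSubLmodule of c0 by <:].

End null_sequence_space.

(** * Functionals that are continuous for uniform convergence on compact sets *)

Section tau_duality.
Context {K : nnegCompleteFieldType} {hK : banach_scalars K}.
Implicit Types V W : normedModType K.

(** [Psi] is dominated by a multiple of the seminorm sup_n [|T (x n)|]; the upper bound [e] stands
    for this supremum. *)
Definition tau_continuous V W (Psi : bounded_op V W -> K^o) :=
  exists2 x : nat -> V, x @ \oo --> 0 & exists2 c : K, 0 <= c &
    forall (T : bounded_op V W) (e : K),
      (forall n, `|T (x n)| <= e) -> `|Psi T| <= c * e.

(** The form in which the approximation property is used: when [Psi T] is the trace of [T] composed
    with a nuclear operator u, the last premise says that u is zero and the conclusion that its
    trace is zero. *)
Lemma ap_functional_id V (Psi : bounded_op V V -> K^o) :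
  approximation_property V -> linear Psi -> tau_continuous Psi ->
  (forall f w, Psi (rank1 f w) = 0) -> Psi (id_op V) = 0.
Proof.
move=> /id_is_tau_limitP Vap lPsi [x x0 [c c0 Psic]] Psi1.
have Psi0 : Psi 0 = 0.
  by have := lPsi (-1) 0 0; rewrite scaler0 addr0 scaleN1r addNr.
have PsiF T : finite_rank T -> Psi T = 0.
  move=> /finite_rankP[s Ts].
  have -> : T = \sum_(p <- s) rank1 p.1 p.2.
    by apply: bounded_op_eq => v; rewrite Ts bounded_op_sum.
  elim: s {Ts} => [|p s IHs]; first by rewrite big_nil.
  by rewrite big_cons -[rank1 _ _]scale1r lPsi Psi1 IHs scaler0 addr0.
apply/eqP; rewrite -normr_le0; apply/ler_addgt0Pr => e e0; rewrite add0r.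
have c1 : 0 < c + 1 by rewrite ltr_wpDl.
have [T Tfr Tx] := Vap x x0 _ (divr_gt0 e0 c1).
have -> : Psi (id_op V) = Psi (id_op V - T).
  by rewrite [_ - T]addrC -scaleN1r lPsi (PsiF T)// scaler0 add0r.
rewrite (le_trans (Psic _ (e / (c + 1)) _))//.
  by move=> n; rewrite -normrN opprB; exact: Tx.
by rewrite mulrCA ler_piMr ?(ltW e0)// ler_pdivrMr// mul1r lerDl.
Qed.

Lemma tau_continuous_series V W (omega : nat -> bounded_op V W -> K^o)
    (x : nat -> V) (c : nat -> K^o) :
  (forall j, linear (omega j)) -> x @ \oo --> 0 -> summable_norm c ->
  (forall j (T : bounded_op V W) (e : K), (forall n, `|T (x n)| <= e) ->
     `|omega j T| <= `|c j| * e) ->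
  exists Psi : bounded_op V W -> K^o, [/\ linear Psi, tau_continuous Psi &
    forall T, series (fun j => omega j T) @ \oo --> Psi T].
Proof.
move=> lomega x0 sc omegac.
have cv T : exists l : K^o, series (fun j => omega j T) @ \oo --> l.
  apply: scalar_seq_complete; apply: summable_norm_cauchy.
  have [e e0 Te] := cvg_bounded_seq (cvg_bounded_op (f := T) x0).
  apply: (summable_normM (ltW e0) _ sc) => j.
  by rewrite mulrC omegac.
have [Psi HPsi] := choice cv.
exists Psi; split => //.
  move=> a S T; apply: (cvg_seq_unique (HPsi _)).
  rewrite (_ : series _ = (fun n => a *: series (omega ^~ S) n + series (omega
    ^~ T) n)).
    by apply: cvgD; [apply: cvgZl_tmp|]; exact: HPsi.
  apply/funext => n; rewrite /series /= scaler_sumr -big_split /=.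
  by apply: eq_bigr => j _; exact: lomega.
have [M M0 cM] := summable_norm_ub sc.
exists x => //; exists M; first exact: ltW.
move=> T e Te; apply: (norm_cvg_le (HPsi T)); exists 0%N => n _.
have e0 : 0 <= e by rewrite (le_trans _ (Te 0%N)).
rewrite (le_trans (ler_norm_sum _ _ _))//.
rewrite (le_trans _ (ler_wpM2r e0 (cM n)))// mulr_suml.
by apply: ler_sum => j _; exact: omegac.
Qed.

Lemma nuclear_functional V W (f : nat -> dual W) (x : nat -> V) :
  summable_norm f /\ x @ \oo --> 0 \/ f @ \oo --> 0 /\ summable_norm x ->
  exists Psi : bounded_op V W -> K^o, [/\ linear Psi, tau_continuous Psi &
    forall T : bounded_op V W,
      series (fun n => f n (T (x n))) @ \oo --> Psi T].
Proof.
have lin n : linear (fun T : bounded_op V W => f n (T (x n)) : K^o).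
  by move=> a S T; rewrite -bounded_opZ -bounded_opD.
case=> -[f0 x0].
  apply: (tau_continuous_series (x := x) (c := fun n => `|f n|)) => //.
    by apply: summable_normM f0 => // n; rewrite mul1r normr_id.
  move=> n T e Te; rewrite normr_id (le_trans (ler_op_norm _ _))//.
  by rewrite ler_wpM2l ?op_norm_ge0.
(* The decay passes from the functionals to the vectors: [y n] has norm [|f n|] when [x n] is
   nonzero, and [|x n|] becomes the summable weight. *)
pose y n := (`|f n| / `|x n|) *: x n.
apply: (tau_continuous_series (x := y) (c := fun n => `|x n|)) => //.
- have /cvg_seqP f0' := f0; apply/cvg_seqP => e e0.
  have [N HN] := f0' e e0; exists N => n Nn.
  have := HN n Nn; rewrite !subr0 => /(le_trans _); apply.
  rewrite /y normrZ normrM normfV !normr_id.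
  have [->|xn0] := eqVneq (x n) 0; first by rewrite normr0 mulr0.
  by rewrite divfK// normr_eq0.
- by apply: summable_normM x0 => // n; rewrite mul1r normr_id.
move=> n T e Te; rewrite normr_id (le_trans (ler_op_norm _ _))//.
have [->|xn0] := eqVneq (x n) 0; first by rewrite bounded_op0 !normr0 mulr0
  mul0r.
rewrite -ler_pdivrMl ?normr_gt0//; have := Te n; rewrite /y bounded_opZ.
by rewrite normrZ normrM normfV !normr_id mulrA (mulrC _^-1).
Qed.

(** The factor 2 allows for a norm that is not attained. A rotation of [u] makes [f u] nonnegative,
    so that such values can be added without cancellation. *)
Lemma dual_norming V (f : dual V) : exists2 u, `|u| <= 1 & `|f| <= 2 * f u.
Proof.
have [->|f0] := eqVneq f 0; first by exists 0; rewrite normr0// mulr0.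
have nf0 : 0 < `|f| by rewrite normr_gt0.
have [u [u1 fu]] : exists u, `|u| <= 1 /\ `|f| <= 2 * `|f u|.
  apply: contrapT => nH; have : `|f| <= `|f| / 2.
    apply: (op_norm_supremums f).2 => _ [u /= u1 <-].
    apply: contrapT => fu; apply: nH; exists u; split => //.
    rewrite mulrC -ler_pdivrMr ?ltr0n// ltW// real_ltNge ?ger0_real ?divr_ge0//.
    exact/negP.
  by apply/negP; rewrite lt_geF// ltr_pdivrMr ?ltr0n// ltr_pMr ?ltr1n.
have fu0 : f u != 0.
  by apply: contraTneq fu => ->; rewrite normr0 mulr0 lt_geF.
exists ((`|f u| / f u) *: u); last by rewrite dualZ divfK.
by rewrite normrZ normrM normfV normr_id divff ?normr_eq0// mul1r.
Qed.

(* A separating functional lives on the space [c0] of null sequences, whose dual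
   is the space of summable sequences of functionals. *)
Lemma tau_dense_criterion V (S : set (bounded_op V V)) :
  S 0 -> (forall a T T', S T -> S T' -> S (a *: T + T')) ->
  (forall (f : nat -> dual V) (x : nat -> V), summable_norm f ->
     x @ \oo --> 0 ->
     (forall T, S T -> series (fun n => f n (T (x n))) @ \oo --> (0 : K^o)) ->
     series (fun n => f n (x n)) @ \oo --> (0 : K^o)) ->
  approximates_id S.
Proof.
move=> S0 Slin Sann x x0 e e0; apply: contrapT => nT.
have null (u : nat -> V) : u @ \oo --> 0 -> u \in @null_sequence K V.
  by move=> u0; exact/asboolP.
have nullP (u : c0 V) : u n @[n --> \oo] --> 0 by have /asboolP := c0P u.
(* The point to separate is the sequence [x] itself: its membership in [C] would give the operator
   denied by [nT]. *)
pose C := [set a : c0 V | exists2 T, S T & forall n, `|a n - T (x n)| <= e].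
have cC : absolutely_convex C.
  move=> a b u v [T ST uT] [T' ST' vT'] ab.
  exists (a *: T + b *: T').
    by apply: (Slin) => //; rewrite -[b *: _]addr0; exact: Slin.
  move=> n; rewrite -[_ - _]/(a *: u n + b *: v n - (a *: T (x n) + b *:
    T' (x n))).
  by rewrite opprD addrACA -!scalerBr; exact:
    (ball_absolutely_convex (uT n) (vT' n) ab).
have ballC (u : c0 V) : (forall n, `|u n| <= e) -> C u.
  by move=> ue; exists 0 => // n; rewrite -[_ - _]/(u n - 0) subr0.
have aC : absorbing C.
  move=> u; have [c c0 uc] := cvg_bounded_seq (nullP u).
  exists (e / c); first exact: divr_gt0.
  apply: ballC => n; rewrite -[(_ *: u) n]/(e / c *: u n) normrZ.
  by rewrite gtr0_norm ?divr_gt0// mulrAC ler_pdivrMr// ler_wpM2l// ltW.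
pose xc := C0 (null x x0).
have nC : ~ C xc.
  by move=> [T ST Tx]; apply: nT; exists T => // n; rewrite distrC; exact: Tx.
have [phi [lphi phix phiC]] := separation cC aC nC.
have phi0 : phi 0 = 0.
  by have := lphi (-1) 0 0; rewrite scaler0 addr0 scaleN1r addNr.
have phiZ a u : phi (a *: u) = a * phi u.
  by have := lphi a u 0; rewrite !addr0 phi0 addr0.
have phiD u v : phi (u + v) = phi u + phi v.
  by have := lphi 1 u v; rewrite !scale1r.
have phiN u : phi (- u) = - phi u by rewrite -scaleN1r phiZ mulN1r.
have phie (u : c0 V) d : 0 < d -> (forall n, `|u n| <= d) -> `|phi u| <= d / e.
  move=> d0 ud; have : `|phi ((e / d) *: u)| <= 1.
    apply/phiC/ballC => n; rewrite -[(_ *: u) n]/(e / d *: u n) normrZ.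
    by rewrite gtr0_norm ?divr_gt0// mulrAC ler_pdivrMr// ler_wpM2l// ltW.
  rewrite phiZ normrM gtr0_norm ?divr_gt0// mulrC -ler_pdivlMr ?divr_gt0//.
  by rewrite mul1r invf_div.
have single_null n (v : V) : (fun m => if m == n then v else 0) \in
  @null_sequence K V.
  apply: (null); apply/cvg_seqP => d d0; exists n.+1 => m nm.
  by rewrite gtn_eqF// subrr normr0 ltW.
pose single n v := C0 (single_null n v).
have singleE n v m : single n v m = if m == n then v else 0 by [].
have sumE (I : Type) (r : seq I) (F : I -> c0 V) m :
    (\sum_(i <- r) F i) m = \sum_(i <- r) F i m.
  by elim/big_rec2: _ => //= i y1 y2 _ <-.
have phi_sum (I : Type) (r : seq I) (F : I -> c0 V) :
    phi (\sum_(i <- r) F i) = \sum_(i <- r) phi (F i).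
  by elim/big_rec2: _ => //= i y1 y2 _ <-.
have bf n : (fun v => phi (single n v)) \in (@bounded_linear K V K^o).
  apply: bounded_linearP.
    move=> a u v; rewrite -lphi; congr phi; apply: val_inj; apply/funext => m.
    rewrite -[RHS]/(a *: single n u m + single n v m) /= .
    by case: eqP => // _; rewrite scaler0 addr0.
  exists e^-1 => v; have [->|v0] := eqVneq v 0.
    rewrite (_ : single n 0 = 0); last first.
      by apply: val_inj; apply/funext => m /=; case: eqP.
    by rewrite phi0 !normr0 mulr0.
  rewrite mulrC phie ?normr_gt0// => m; rewrite singleE.
  by case: eqP => // _; rewrite normr0.
pose f n : dual V := BoundedOp (bf n).
have fE n v : f n v = phi (single n v) by [].
have truncE (u : nat -> V) N m :
    (\sum_(0 <= n < N) single n (u n)) m = if (m < N)%N then u m else 0.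
  rewrite sumE; under eq_bigr do rewrite singleE.
  have [mN|Nm] := ltnP m N.
    rewrite (bigD1_seq m) ?mem_index_iota ?iota_uniq//= eqxx big1 ?addr0//.
    by move=> n /negPf nm; rewrite eq_sym nm.
  rewrite big_nat_cond big1// => n /andP[/andP[_ nN] _].
  by rewrite gtn_eqF// (leq_trans nN).
(* A truncated sequence of norming vectors has sup norm at most 1, so [phi] is at most [e^-1] on it,
   while its value there is at least half the sum of the norms. *)
have sf : summable_norm f.
  have [u Hu] : exists u : nat -> V, forall n, `|u n| <= 1 /\ `|f n| <= 2 * f n
    (u n).
    have /choice[u Hu] n : exists u, `|u| <= 1 /\ `|f n| <= 2 * f n u.
      by have [u] := dual_norming (f n); exists u.
    by exists u.
  exists (2 / e) => N; rewrite (@le_trans _ _ (2 * phi (\sum_(0 <= n < N)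
    single n (u n))))//.
    rewrite phi_sum mulr_sumr; apply: ler_sum => n _; exact: (Hu n).2.
  rewrite ler_wpM2l// -[e^-1]mul1r (le_trans (real_ler_norm _))//; last first.
    apply: phie => // m; rewrite truncE; case: ifP => _;
      last by rewrite normr0 ler01.
    exact: (Hu m).1.
  rewrite ger0_real// phi_sum sumr_ge0// => n _.
  by rewrite -fE -(pmulr_rge0 _ (ltr0n K 2)) (le_trans _ (Hu n).2).
have phi_series (u : c0 V) : series (fun n => f n (u n)) @ \oo --> phi u.
  have /cvg_seqP u0 := nullP u; apply/cvg_seqP => d d0.
  have [N HN] := u0 (d * e) (mulr_gt0 d0 e0); exists N => n Nn.
  rewrite distrC /series /= -phi_sum.
  have -> : phi u - phi (\sum_(0 <= i < n) single i (u i)) =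
      phi (u - \sum_(0 <= i < n) single i (u i)).
    by rewrite phiD phiN.
  rewrite -[leRHS](mulfK (lt0r_neq0 e0)) phie ?mulr_gt0// => m.
  rewrite -[(u - _) m]/(u m - (\sum_(0 <= i < n) single i (u i)) m) truncE.
  case: ltnP => [_|nm]; first by rewrite subrr normr0 mulr_ge0// ltW.
  exact: HN (leq_trans Nn nm).
have f0 := Sann f x sf x0.
have /(_ _)/cvg_seq_unique/(_ (phi_series xc)) /esym := f0.
rewrite phix => H; suff : (1 : K) = 0 by move/eqP; rewrite oner_eq0.
apply: H => T ST.
have Txn : (fun n => T (x n)) @ \oo --> 0.
  by rewrite -[X in _ --> X](bounded_op0 T); exact: cvg_bounded_op.
have := phi_series (C0 (null _ Txn)).
rewrite (_ : phi _ = 0)//; apply: bounded_multiples0 => a.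
rewrite -phiZ; apply: phiC; exists (a *: T).
  by rewrite -[a *: T]addr0; exact: Slin.
by move=> n; rewrite -[_ - _]/(a *: T (x n) - a *: T (x n)) subrr normr0 ltW.
Qed.

End tau_duality.

(** * Open mapping theorem *)

Section open_mapping.
Context {K : nnegCompleteFieldType}.
Implicit Types V W : normedModType K.

Lemma sum_half_le (n : nat) : \sum_(0 <= j < n) (2^-1 : K) ^+ j <= 2.
Proof.
suff -> : \sum_(0 <= j < n) (2^-1 : K) ^+ j = 2 - 2 * 2^-1 ^+ n.
  by rewrite gerBl mulr_ge0// exprn_ge0// invr_ge0.
elim: n => [|n IHn]; first by rewrite big_geq// expr0 mulr1 subrr.
by rewrite big_nat_recr//= IHn exprS; set g := _ ^+ n; field.
Qed.

(** Baire's argument. Otherwise there are nested balls, with radii at least halved each time, of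
    which the one numbered [n.+1] misses the image of the ball of radius [n]; their common point is
    some [q v], a contradiction once [n >= |v|]. *)
Lemma baire_ball V W (q : bounded_op V W) : seq_complete W ->
  surjective_op q -> exists n w0 r, 0 < r /\ forall w, `|w - w0| <= r ->
    forall d : K, 0 < d -> exists2 v, `|v| <= n%:R & `|w - q v| <= d.
Proof.
move=> cW qsurj; apply: contrapT => nH.
have step (nz : nat * (W * {r : K | 0 < r})) : exists z' : W * {r : K | 0 < r},
    [/\ `|z'.1 - nz.2.1| <= sval nz.2.2 / 2, sval z'.2 <= sval nz.2.2 / 2 &
        forall v, `|v| <= nz.1%:R -> ~ `|z'.1 - q v| <= sval z'.2].
  move: nz => [n [w0 [r r0]]] /=.
  have r20 : 0 < r / 2 by rewrite divr_gt0 ?ltr0n.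
  apply: contrapT => nz; apply: nH; exists n, w0, (r / 2); split => //.
  move=> w ww0 d d0; apply: contrapT => nv; apply: nz.
  have [d' [d'0 d'd d'r]] : exists d', [/\ 0 < d', d' <= d & d' <= r / 2].
    have [dr|rd] := real_leP (gtr0_real d0) (gtr0_real r20); first by exists d.
    by exists (r / 2); split => //; exact: ltW.
  exists (w, exist _ d' d'0); split => //= v vn wv; apply: nv; exists v => //.
  exact: le_trans wv d'd.
have [F HF] := choice step.
pose a := fix a n := if n is m.+1 then F (m, a m) else ((0 : W), exist (fun r :
  K => 0 < r) 1 ltr01).
pose r n := sval (a n).2; pose z n := (a n).1.
have r0 n : 0 < r n := svalP (a n).2.
have aS n : [/\ `|z n.+1 - z n| <= r n / 2, r n.+1 <= r n / 2 &
    forall v, `|v| <= n%:R -> ~ `|z n.+1 - q v| <= r n.+1] := HF (n, a n).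
have rle n : r n <= 2^-1 ^+ n.
  elim: n => [|n IHn]; first by rewrite expr0.
  have [_ /le_trans rn _] := aS n; apply: rn.
  by rewrite exprS mulrC ler_wpM2l// invr_ge0.
have zb n m : `|z (n + m)%N - z n| + r (n + m)%N <= r n.
  elim: m => [|m IHm]; first by rewrite addn0 subrr normr0 add0r.
  rewrite addnS (le_trans _ IHm)// -(subrKA (z (n + m)%N)).
  have [zS rS _] := aS (n + m)%N.
  rewrite (le_trans (lerD (ler_normD _ _) rS))// addrAC [leRHS]addrC lerD2r.
  by rewrite [leRHS]splitr lerD2r.
have zr n m : `|z (n + m)%N - z n| <= r n.
  by rewrite (le_trans _ (zb n m))// lerDl ltW.
have [|l zl] := cW z.
  move=> e e0; have /cvg_seqP/(_ _ (divr_gt0 e0 (ltr0n _ 2)))[N HN] :=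
    @cvg_half K.
  have rN : r N <= e / 2.
    rewrite (le_trans (rle N))//; have := HN N (leqnn N).
    by rewrite subr0 gtr0_norm ?exprn_gt0 ?invr_gt0.
  exists N => m n Nm Nn; rewrite -(subrKA (z N)) (le_trans (ler_normD _ _))//.
  rewrite [leRHS]splitr lerD//.
    by rewrite -(subnKC Nm) (le_trans (zr _ _)).
  by rewrite distrC -(subnKC Nn) (le_trans (zr _ _)).
have lz n : `|l - z n| <= r n.
  apply: (@norm_cvg_le _ _ (fun m => z m - z n)).
    by apply: cvgB => //; exact: cvg_cst.
  by exists n => m nm; rewrite -(subnKC nm) zr.
have [v qv] : exists v, q v = l.
  have : [set: W] l by [].
  by rewrite -qsurj => -[v _ <-]; exists v.
have [n vn] : exists n, `|v| <= n%:R.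
  have v1 : 0 < `|v| + 1 by rewrite ltr_wpDl.
  have v1' : 0 < (`|v| + 1)^-1 by rewrite invr_gt0.
  have [n] := archimedean_inv v1'.
  rewrite lef_pV2 ?posrE ?ltr0n// => Hn.
  by exists n.+1; rewrite (le_trans _ Hn)// lerDl.
have [_ _ /(_ v vn)] := aS n; apply; rewrite qv distrC; exact: lz.
Qed.

Lemma open_mapping_approx V W (q : bounded_op V W) : seq_complete W ->
  surjective_op q -> exists2 M : K, 0 < M & forall w (d : K), 0 < d ->
    exists2 v, `|v| <= M * `|w| & `|w - q v| <= d.
Proof.
move=> cW qsurj; have [n [w0 [r [r0 Hr]]]] := baire_ball cW qsurj.
(* Subtracting approximations of [w0 + w] and of [w0] recentres the ball at 0, at the price of a
   factor 2. *)
have H w (d : K) : `|w| <= r -> 0 < d ->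
    exists2 v, `|v| <= 2 * n%:R & `|w - q v| <= d.
  move=> wr d0; have d20 : 0 < d / 2 by rewrite divr_gt0 ?ltr0n.
  have [|v1 v1n Hv1] := Hr (w0 + w) _ _ d20;
    first by rewrite addrAC subrr add0r.
  have [|v2 v2n Hv2] := Hr w0 _ _ d20; first by rewrite subrr normr0 ltW.
  exists (v1 - v2).
    by rewrite (le_trans (ler_normB _ _))// mulr_natl mulr2n lerD.
  rewrite bounded_opB (_ : _ - _ = (w0 + w - q v1) - (w0 - q v2)).
    by rewrite (le_trans (ler_normB _ _))// [leRHS]splitr lerD.
  by rewrite !opprB [RHS]addrC -[w0 + w - _]addrA subrKA addrCA.
exists (2 * n.+1%:R / r) => [|w d d0]; first by rewrite divr_gt0 ?mulr_gt0
  ?ltr0n.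
have [->|w0'] := eqVneq w 0.
  by exists 0; rewrite ?bounded_op0 ?subrr !normr0 ?mulr0 // ltW.
have nw : 0 < `|w| by rewrite normr_gt0.
have [||v vn Hv] := H ((r / `|w|) *: w) (d * (r / `|w|)).
- by rewrite normrZ gtr0_norm ?divr_gt0// divfK ?gt_eqF.
- by rewrite mulr_gt0// divr_gt0.
exists ((`|w| / r) *: v).
  rewrite normrZ gtr0_norm ?divr_gt0// mulrC [leRHS]mulrAC -[leRHS]mulrA.
  rewrite ler_wpM2r ?divr_ge0 ?(ltW r0)// (le_trans vn)// ler_wpM2l// ler_nat//.
rewrite bounded_opZ -(ler_pM2r (divr_gt0 r0 nw)) -[X in _ * X]gtr0_norm
  ?divr_gt0//.
rewrite mulrC -normrZ scalerBr scalerA.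
by rewrite (_ : r / `|w| * _ = 1) ?scale1r//; field; rewrite !gt_eqF.
Qed.

Theorem open_mapping V W (q : bounded_op V W) :
  seq_complete V -> seq_complete W -> surjective_op q ->
  exists2 M : K, 0 < M &
    forall w, exists2 v, q v = w & `|v| <= M * `|w|.
Proof.
move=> cV cW qsurj; have [M M0 HM] := open_mapping_approx cW qsurj.
(* One correction halves the residual, so the corrections sum to a preimage of norm at most
   [M * 2 * |w|]. *)
have /choice[g Hg] w : exists v, `|v| <= M * `|w| /\ `|w - q v| <= 2^-1 * `|w|.
  have [->|w0] := eqVneq w 0.
    by exists 0; rewrite bounded_op0 subrr !normr0 !mulr0.
  have [|v vM Hv] := HM w (2^-1 * `|w|); last by exists v.
  by rewrite mulr_gt0 ?invr_gt0 ?ltr0n ?normr_gt0.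
exists (M * 2) => [|w]; first by rewrite mulr_gt0 ?ltr0n.
pose z n := iter n (fun w => w - q (g w)) w.
have zn n : `|z n| <= 2^-1 ^+ n * `|w|.
  elim: n => [|n IHn]; first by rewrite expr0 mul1r.
  rewrite (le_trans (Hg (z n)).2)// exprS -mulrA ler_wpM2l// invr_ge0//.
have gM n : \sum_(0 <= j < n) `|g (z j)| <= M * 2 * `|w|.
  rewrite (@le_trans _ _ (\sum_(0 <= j < n) M * `|w| * 2^-1 ^+ j))//.
    apply: ler_sum => j _; rewrite (le_trans (Hg (z j)).1)// -mulrA.
    by rewrite ler_wpM2l ?(ltW M0)// mulrC zn.
  rewrite -mulr_sumr [leRHS]mulrAC ler_wpM2l ?mulr_ge0 ?(ltW M0)//.
  exact: sum_half_le.
have [|v gv] := cV (series (fun n => g (z n))).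
  by apply: summable_norm_cauchy; exists (M * 2 * `|w|).
exists v; last first.
  apply: (norm_cvg_le gv); exists 0%N => n _.
  by rewrite (le_trans (ler_norm_sum _ _ _)).
have qz n : q (series (fun n => g (z n)) n) = w - z n.
  elim: n => [|n IHn].
    by rewrite /series /= big_geq// bounded_op0 subrr.
  by rewrite seriesSr bounded_opD IHn /= opprB [in RHS]addrA [RHS]addrAC.
apply: (cvg_seq_unique (cvg_bounded_op (f := q) gv)).
rewrite (_ : (fun n => _) = (fun n => w - z n)); last exact/funext.
rewrite -[X in _ --> X]subr0; apply: cvgB; first exact: cvg_cst.
apply/cvg_seqP => e e0; have w1 : 0 < `|w| + 1 by rewrite ltr_wpDl.
have /cvg_seqP/(_ _ (divr_gt0 e0 w1))[N HN] := @cvg_half K.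
exists N => n Nn; rewrite subr0 (le_trans (zn n))//.
have := HN n Nn; rewrite subr0 gtr0_norm ?exprn_gt0 ?invr_gt0// => hn.
rewrite (le_trans (ler_wpM2r _ hn))// mulrAC ler_pdivrMr//.
by rewrite ler_wpM2l ?(ltW e0)// lerDl.
Qed.

(** The constant is uniform in [f], so a summable sequence of functionals factors through [q] with
    summable factors. *)
Lemma operator_factor V W (q : bounded_op V W) : seq_complete V ->
  seq_complete W -> surjective_op q ->
  exists2 M : K, 0 < M & forall U (f : bounded_op V U),
    (forall v, q v = 0 -> f v = 0) ->
    exists2 g : bounded_op W U, comp_op g q = f & `|g| <= M * `|f|.
Proof.
move=> cV cW /(open_mapping cV cW)[M M0 /= qM]; exists M => // U f fq.
have /choice[s Hs] w : exists v, q v = w /\ `|v| <= M * `|w|.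
  by have [v] := qM w; exists v.
have fs v w : q v = w -> f (s w) = f v.
  move=> qv; apply/eqP; rewrite -subr_eq0 -bounded_opB fq//.
  by rewrite bounded_opB (Hs w).1 qv subrr.
have fsb w : `|f (s w)| <= M * `|f| * `|w|.
  rewrite (le_trans (ler_op_norm f _))// [M * _]mulrC -mulrA.
  by rewrite ler_wpM2l ?op_norm_ge0// (Hs w).2.
have bg : (fun w => f (s w)) \in (@bounded_linear K W U).
  apply: bounded_linearP; last by exists (M * `|f|).
  move=> a u v; rewrite (fs (a *: s u + s v)) ?bounded_opD ?bounded_opZ//.
  by rewrite !(Hs _).1.
exists (BoundedOp bg); first by apply: bounded_op_eq => v; exact: fs.
by apply: op_norm_le => //; rewrite mulr_ge0 ?(ltW M0).
Qed.

End open_mapping.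

(** * Nuclear operators into the bidual *)

Section tensors.
Context {K : nnegCompleteFieldType} {hK : banach_scalars K}.
Implicit Types U V : normedModType K.

Lemma ler_norm_op U V (f : bounded_op U V) x : `|f x| <= `|f| * `|x|.
Proof. exact: ler_op_norm. Qed.

Lemma norm_op_le U V (f : bounded_op U V) (c : K) : 0 <= c ->
  (forall x, `|f x| <= c * `|x|) -> `|f| <= c.
Proof. exact: op_norm_le. Qed.

Lemma bounded_op_series U V (f : bounded_op U V) (t : nat -> U) :
  (fun n => f (series t n)) = series (fun n => f (t n)).
Proof. by apply/funext => n; exact: linear_sum. Qed.

Lemma tensor_bounded_linear U V (a : U) (h : dual V) :
  (fun B : bounded_op U V => h (B a)) \in
    (@bounded_linear K (bounded_op U V) K^o).
Proof.
apply: bounded_linearP => [c B B'|]; first by rewrite -bounded_opZ -bounded_opD.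
exists (`|h| * `|a|) => B; rewrite (le_trans (ler_norm_op h _))//.
by rewrite -mulrA ler_wpM2l// mulrC ler_norm_op.
Qed.

(** It is used with [U] = Z^* and [V] = Y^*. The operators from Z^* to Y^* form the dual of the
    projective tensor product of Z^* and Y, so the norm of functionals on them is the projective
    norm on such tensors, while [h] may range over all of Y^**. *)
Definition tensor U V (a : U) (h : dual V) : dual (bounded_op U V) :=
  BoundedOp (tensor_bounded_linear a h).

Lemma norm_tensor U V (a : U) (h : dual V) : `|tensor a h| <= `|a| * `|h|.
Proof.
apply: norm_op_le => [|B /=]; first exact: mulr_ge0.
rewrite (le_trans (ler_norm_op h _))// [`|a| * _]mulrC -mulrA ler_wpM2l//.
by rewrite mulrC ler_norm_op.
Qed.

Lemma tensorDl U V (c : K) (a b : U) (h : dual V) :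
  tensor (c *: a + b) h = c *: tensor a h + tensor b h.
Proof.
by apply: bounded_op_eq => B /=; rewrite bounded_opD bounded_opZ linearP.
Qed.

Lemma tensorDr U V (c : K) (a : U) (h k : dual V) :
  tensor a (c *: h + k) = c *: tensor a h + tensor a k.
Proof. exact: bounded_op_eq. Qed.

Lemma tensorZl U V (c : K) (a : U) (h : dual V) :
  tensor (c *: a) h = c *: tensor a h.
Proof. by apply: bounded_op_eq => B /=; rewrite bounded_opZ dualZ. Qed.

Lemma tensorZr U V (c : K) (a : U) (h : dual V) :
  tensor a (c *: h) = c *: tensor a h.
Proof. exact: bounded_op_eq. Qed.

Lemma tensor_form_bounded_linear U V (Phi : dual (dual (bounded_op U V)))
    (a : U) :
  (fun h : dual V => Phi (tensor a h)) \in (@bounded_linear K (dual V) K^o).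
Proof.
apply: bounded_linearP => [c h k|].
  by rewrite tensorDr bounded_opD bounded_opZ.
exists (`|Phi| * `|a|) => h; rewrite (le_trans (ler_norm_op Phi _))//.
by rewrite -mulrA ler_wpM2l// norm_tensor.
Qed.

Lemma tensor_operator_bounded_linear U V (Phi : dual (dual (bounded_op U V))) :
  (fun a : U => BoundedOp (tensor_form_bounded_linear Phi a) : dual (dual V))
    \in (@bounded_linear K U (dual (dual V))).
Proof.
apply: bounded_linearP => [c a b|].
  by apply: bounded_op_eq => h /=; rewrite tensorDl bounded_opD bounded_opZ.
exists `|Phi| => a; apply: norm_op_le => [|h /=]; first exact: mulr_ge0.
rewrite (le_trans (ler_norm_op Phi _))// -mulrA ler_wpM2l//.
exact: norm_tensor.
Qed.

(** It represents [Phi] on tensors; for [V] = Y^* its values lie in the third dual of Y. *)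
Definition tensor_operator U V (Phi : dual (dual (bounded_op U V))) :
    bounded_op U (dual (dual V)) :=
  BoundedOp (tensor_operator_bounded_linear Phi).

Lemma cvg_series_cons V (t0 : V) (t : nat -> V) (l : V) :
  series t @ \oo --> l ->
  series (fun n => if n is m.+1 then t m else t0) @ \oo --> t0 + l.
Proof.
move=> tl; rewrite -cvg_shiftS /=.
rewrite (_ : (fun n => _) = (fun n => t0 + series t n)).
  by apply: cvgD => //; exact: cvg_cst.
by apply/funext => n; rewrite /series /= big_nat_recl.
Qed.

End tensors.

Section weakly_nuclear.
Context {K : nnegCompleteFieldType} {hK : banach_scalars K}.
Variables Y Z : normedModType K.
Local Notation L := (bounded_op (dual Z) (dual Y)).
Local Notation J := (bidual Y).

(* The sum of the [a n (x) h n] is an operator from [Z] to [Y] that is nuclear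
   as an operator into the bidual of [Y]. *)
Definition bidual_nuclear (a : nat -> dual Z) (h : nat -> dual (dual Y)) :=
  [/\ summable_norm a, h @ \oo --> 0 &
    forall z, exists y, series (fun n => a n z *: h n) @ \oo --> J y].

(* [Q] is the projection of the third dual of [Y] onto its dual.  The tensors
   [sum B (a n) (x) h n] and [sum B (a n) (x) (h n o Q)] define the same
   operator on the third dual, so their traces agree. *)
Lemma bidual_nuclear_trace (a : nat -> dual Z) (h : nat -> dual (dual Y))
    (B : bounded_op (dual Z) (dual (dual (dual Y)))) :
  approximation_property (dual (dual (dual Y))) -> bidual_nuclear a h ->
  series (fun n => B (a n) (h n) - h n (adjoint J (B (a n)))) @ \oo
    --> (0 : K^o).
Proof.
move=> Y3ap [sa h0 aJ].
pose Q := comp_op (bidual (dual Y)) (adjoint J).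
pose k := comp_op (id_op _ - adjoint Q) (bidual (dual (dual Y))).
have kE u w : k u w = w u - u (adjoint J w) by [].
have kh0 : (fun n => k (h n)) @ \oo --> 0.
  by rewrite -[X in _ --> X](bounded_op0 k); exact: cvg_bounded_op.
have sBa : summable_norm (fun n => B (a n)).
  apply: summable_normM sa; first exact: (op_norm_ge0 B).
  by move=> n; exact: ler_norm_op.
have [Psi [lPsi tPsi cPsi]] := nuclear_functional (or_intror (conj kh0 sBa)).
have <- : Psi (id_op _) = 0; last exact: cPsi.
apply: (ap_functional_id Y3ap lPsi tPsi) => kappa w.
apply: (cvg_seq_unique (cPsi _)).
(* On a rank one operator the partial sums are [kappa (B (D n))], so it is enough that [D n] tends
   to 0 in Z^*. *)
pose D n := series (fun n => k (h n) w *: a n) n.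
have kappaD n : series (fun n => k (h n) (rank1 kappa w (B (a n)))) n
    = kappa (B (D n)).
  elim: n => [|n IHn].
    by rewrite /D /series /= !big_geq// !bounded_op0.
  rewrite /D !seriesSr -/(D n) IHn !bounded_opD !bounded_opZ; congr (_ + _).
  exact: mulrC.
rewrite (_ : series _ = (fun n => kappa (B (D n)))); last exact/funext.
suff D0 : D n @[n --> \oo] --> 0.
  rewrite -[X in _ --> X](bounded_op0 (comp_op kappa B)).
  exact: (cvg_bounded_op (f := comp_op kappa B)).
have [c c0 kc] := cvg_bounded_seq kh0.
have [G DG] : exists G : dual Z, D n @[n --> \oo] --> G.
  apply: dual_seq_complete; apply: summable_norm_cauchy.
  apply: summable_normM sa; first by exact: (mulr_ge0 (ltW c0) (normr_ge0 w)).
  move=> n; rewrite normrZ ler_wpM2r// (le_trans (ler_norm_op _ _))//.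
  by rewrite ler_wpM2r.
suff <- : G = 0 by [].
apply: bounded_op_eq => z; have [y hy] := aJ z.
apply: (cvg_seq_unique (cvg_bounded_op (f := evaluation z) DG)).
(* The limit [G] takes at [z] the value [f (J y)], where [J y] is the sum of the [a n z *: h n]; and
   [w - Q w] annihilates the image of [Y]. *)
pose f : dual (dual (dual Y)) := w - Q w.
have fJ : f (J y) = 0.
  by rewrite -[LHS]/(w (J y) - Q w (J y)); exact: subrr.
rewrite -[X in _ --> X]/(0 : K^o) -fJ.
rewrite (_ : (fun n => _) = (fun n => f (series (fun n => a n z *: h n) n))).
  exact: cvg_bounded_op.
rewrite /D !bounded_op_series; congr series; apply/funext => n.
by rewrite !bounded_opZ; exact: mulrC.
Qed.

Definition list_tensor (s : seq (dual Z * Y)) : dual L :=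
  \sum_(p <- s) tensor p.1 (J p.2).

Let scale_list (c : K) (s : seq (dual Z * Y)) := [seq (c *: p.1, p.2) | p <- s].

Let list_tensor_scale c s : list_tensor (scale_list c s) = c *: list_tensor s.
Proof.
rewrite /list_tensor big_map scaler_sumr.
by apply: eq_bigr => p _; rewrite tensorZl.
Qed.

Let norm_scale_list c s :
  \sum_(p <- scale_list c s) `|p.1| = `|c| * \sum_(p <- s) `|p.1|.
Proof.
by rewrite big_map mulr_sumr; apply: eq_bigr => p _; rewrite normrZ.
Qed.

(** The remainder after an approximation is of the same kind, which allows iteration; the subtracted
    terms are put in front of the series. *)
Lemma bidual_nuclear_sub a h (r : dual L) (s : seq (dual Z * Y)) :
  bidual_nuclear a h -> series (fun n => tensor (a n) (h n)) @ \oo --> r ->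
  exists a' h', bidual_nuclear a' h' /\
    series (fun n => tensor (a' n) (h' n)) @ \oo --> r - list_tensor s.
Proof.
rewrite /list_tensor; elim: s a h r => [|[b y] s IHs] a h r [sa h0 aJ] ar.
  by exists a, h; split; [split|rewrite big_nil subr0].
rewrite big_cons opprD addrA.
pose a1 n := if n is m.+1 then a m else b.
pose h1 n := if n is m.+1 then h m else - J y.
apply: (IHs a1 h1).
  split.
  - have [M aM] := sa; exists (`|b| + M) => -[|n]; last first.
      by rewrite big_nat_recl//= lerD2l.
    by rewrite big_geq// addr_ge0// (le_trans _ (aM 0%N))// big_geq.
  - by rewrite -cvg_shiftS.
  - move=> z; have [y' hy'] := aJ z; exists (- (b z *: y) + y').
    rewrite bounded_opD -scalerN bounded_opZ -[- y]scaleN1r bounded_opZ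
      scaleN1r.
    rewrite (_ : (fun n => _) = (fun n => if n is m.+1 then a m z *:
      h m else b z *: - J y)).
      exact: cvg_series_cons.
    by apply/funext => -[].
rewrite addrC (_ : (fun n => _) = (fun n =>
  if n is m.+1 then tensor (a m) (h m) else - tensor b (J y))).
  exact: cvg_series_cons.
by apply/funext => -[|//]; rewrite /= -[- J y]scaleN1r tensorZr scaleN1r.
Qed.

(* A functional [Phi] separating [r] from the set [C] below gives an operator
   [B], and the trace identity shows that [Phi r] depends only on the part [B']
   of [B], which [C] controls. *)
Lemma bidual_nuclear_approx a h (r : dual L) (d : K) :
  approximation_property (dual (dual (dual Y))) ->
  bidual_nuclear a h -> series (fun n => tensor (a n) (h n)) @ \oo --> r ->
  0 < d -> `|r| <= d ->
  exists s : seq (dual Z * Y), [/\ forall p, p \in s -> `|p.2| <= 1,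
    \sum_(p <- s) `|p.1| <= 2 * d & `|r - list_tensor s| <= d / 4].
Proof.
move=> Y3ap ah ar d0 rd; have d40 : 0 < d / 4 by rewrite divr_gt0 ?ltr0n.
(* The allowance [2 * d] yields [|B'| <= (2 * d)^-1], hence [|Phi r| <= 1/2], against [Phi r = 1].
   The tolerance [d / 4] makes [C] contain a ball and gives geometric decay under iteration. *)
pose C := [set t : dual L | exists s : seq (dual Z * Y),
  [/\ forall p, p \in s -> `|p.2| <= 1, \sum_(p <- s) `|p.1| <= 2 * d &
      `|t - list_tensor s| <= d / 4]].
apply: contrapT => nC.
have cC : absolutely_convex C.
  move=> c c' t t' [s [s1 sd st]] [s' [s'1 s'd s't']] cc'.
  exists (scale_list c s ++ scale_list c' s').
  split.
  - by move=> p; rewrite mem_cat => /orP[] /mapP[p' p's ->] /=;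
      [exact: s1|exact: s'1].
  - rewrite big_cat/= !norm_scale_list (le_trans (lerD (ler_wpM2l _ sd)
      (ler_wpM2l _ s'd)))//.
    by rewrite -mulrDl ler_piMl// mulr_ge0 ?(ltW d0).
  rewrite /list_tensor big_cat/= -!/(list_tensor _) !list_tensor_scale.
  rewrite opprD addrACA -!scalerBr.
  exact: (ball_absolutely_convex st s't' cc').
have [|Phi [Phir _ PhiC]] := normed_separation cC d40 _ nC.
  move=> t td; exists [::]; split => //; rewrite ?big_nil ?mulr_ge0 ?(ltW d0)//.
  by rewrite /list_tensor big_nil subr0.
pose B := tensor_operator Phi.
pose B' : L := comp_op (adjoint J) B.
have B'd : `|B'| <= (2 * d)^-1.
  have d20 : 0 < 2 * d by rewrite mulr_gt0 ?ltr0n.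
  have dV : 0 <= (2 * d)^-1 by rewrite invr_ge0 ltW.
  apply: norm_op_le => // b; apply: norm_op_le => [|y]; first exact: mulr_ge0.
  have [->|b0] := eqVneq b 0.
    by rewrite bounded_op0 [X in `|X|](_ : _ = 0)// normr0 !mulr_ge0.
  have [->|y0] := eqVneq y 0; first by rewrite bounded_op0 normr0 !mulr_ge0.
  rewrite -[B' b y]/(Phi (tensor b (J y))).
  have nb : 0 < `|b| by rewrite normr_gt0.
  have ny : 0 < `|y| by rewrite normr_gt0.
  have : `|Phi (tensor (((2 * d) / `|b|) *: b) (J (`|y|^-1 *: y)))| <= 1.
    apply: PhiC; exists [:: (((2 * d) / `|b|) *: b, `|y|^-1 *: y)]; split.
    - move=> p; rewrite inE => /eqP-> /=.
      by rewrite normrZ normfV normr_id mulVf ?gt_eqF.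
    - by rewrite big_seq1 /= normrZ gtr0_norm ?divr_gt0// divfK ?gt_eqF.
    - by rewrite /list_tensor big_seq1 subrr normr0 ltW.
  rewrite bounded_opZ tensorZl tensorZr scalerA dualZ normrM.
  rewrite gtr0_norm ?mulr_gt0 ?divr_gt0 ?invr_gt0// => H.
  rewrite -mulrA -ler_pdivrMl ?invr_gt0// invrK.
  set F := `|Phi _| in H *.
  have -> : 2 * d * F = `|b| * `|y| * (2 * d / `|b| / `|y| * F).
    by field; rewrite !gt_eqF.
  by rewrite ler_piMr// mulr_ge0.
have PhirE : Phi r = r B'.
  have cPhi := cvg_bounded_op (f := Phi) ar.
  have crB := cvg_bounded_op (f := evaluation B') ar.
  apply/eqP; rewrite -subr_eq0; apply/eqP.
  apply: (cvg_seq_unique (cvgB cPhi crB)).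
  rewrite (_ : _ - _ = series (fun n => B (a n) (h n) - h n (adjoint J (B (a
    n))))).
    exact: bidual_nuclear_trace.
  rewrite !bounded_op_series; apply/funext => n.
  by rewrite [RHS]/series /= sumrB.
have := ler_norm_op r B'; rewrite -PhirE Phir normr1 => H.
have := le_trans H (ler_pM (normr_ge0 _) (normr_ge0 _) rd B'd).
rewrite invfM mulrCA mulfV ?gt_eqF// mulr1; apply/negP.
by rewrite lt_geF// invf_lt1 ?ltr1n ?ltr0n.
Qed.

(** Iterated approximation of the remainders. The factor 4^-j is written as a product so that half
    of the decay can later be moved to the vectors, which are only bounded by 1. *)
Theorem bidual_nuclear_series a h (r : dual L) :
  approximation_property (dual (dual (dual Y))) ->
  bidual_nuclear a h -> series (fun n => tensor (a n) (h n)) @ \oo --> r ->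
  exists (s : nat -> seq (dual Z * Y)) (d : K),
    [/\ 0 <= d, forall j p, p \in s j -> `|p.2| <= 1,
    forall j, \sum_(p <- s j) `|p.1| <= d * (2^-1 ^+ j * 2^-1 ^+ j) &
    series (fun j => list_tensor (s j)) @ \oo --> r].
Proof.
move=> Y3ap ah ar; pose d := `|r| + 1.
pose D n : K := d * (2^-1 ^+ n * 2^-1 ^+ n).
have d0 : 0 < d by rewrite ltr_wpDl.
have h0 n : 0 < (2^-1 : K) ^+ n by rewrite exprn_gt0 ?invr_gt0.
have D0 n : 0 < D n by rewrite !mulr_gt0.
have D4 n : D n / 4 = D n.+1.
  by rewrite /D !exprS; set g := _ ^+ n; field.
pose N (r' : dual L) := exists a h, bidual_nuclear a h /\
  series (fun n => tensor (a n) (h n)) @ \oo --> r'.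
(* The conditions on the remainder are premises under the existential, so that [choice] applies to
   all pairs; the empty list is a default. *)
have step (nr : nat * dual L) : exists s : seq (dual Z * Y),
    N nr.2 -> `|nr.2| <= D nr.1 ->
    [/\ forall p, p \in s -> `|p.2| <= 1, \sum_(p <- s) `|p.1| <= 2 * D nr.1,
      `|nr.2 - list_tensor s| <= D nr.1.+1 & N (nr.2 - list_tensor s)].
  case: nr => n r' /=; have [[a' [h' [ah' ar']]]|nN] := pselect (N r');
    last first.
    by exists [::] => /nN.
  have [rD|rD] := pselect (`|r'| <= D n); last by exists [::] => _ /rD.
  have [s [s1 sd rs]] := bidual_nuclear_approx Y3ap ah' ar' (D0 n) rD.
  exists s => _ _; split => //; first by rewrite -D4.
  exact: bidual_nuclear_sub ah' ar'.
have [F HF] := choice step.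
pose u := fix u n := if n is m.+1 then u m - list_tensor (F (m, u m)) else r.
have uS n : u n.+1 = u n - list_tensor (F (n, u n)) by [].
have Hu n : N (u n) /\ `|u n| <= D n.
  elim: n => [|n [Nu uD]].
    split; first by exists a, h.
    by rewrite /D expr0 !mulr1 lerDl.
  by have [_ _ ? ?] := HF (n, u n) Nu uD; split; rewrite uS.
exists (fun n => F (n, u n)), (2 * d); split.
- by rewrite mulr_ge0// ltW.
- by move=> j p; have [Nu uD] := Hu j; have [+ _ _ _] := HF (j, u j) Nu uD;
    apply.
- move=> j; have [Nu uD] := Hu j; have [_ + _ _] := HF (j, u j) Nu uD.
  by rewrite /D /= mulrA.
have suE n : series (fun n => list_tensor (F (n, u n))) n = r - u n.
  elim: n => [|n IHn]; first by rewrite /series /= big_geq// subrr.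
  by rewrite seriesSr IHn uS opprB [in RHS]addrA [RHS]addrAC.
rewrite (_ : series _ = (fun n => r - u n)); last exact/funext.
rewrite -[X in _ --> X]subr0; apply: cvgB; first exact: cvg_cst.
apply/cvg_seqP => e e0; have /cvg_seqP/(_ _ (divr_gt0 e0 d0))[M HM] :=
  @cvg_half K.
exists M => n Mn; rewrite subr0 (le_trans (Hu n).2)// /D mulrC -ler_pdivlMr//.
have := HM n Mn; rewrite subr0 gtr0_norm// => /(le_trans _); apply.
by rewrite ler_piMl ?(ltW (h0 n))// exprn_ile1 ?invr_ge0// invf_le1 ?ler1n.
Qed.

End weakly_nuclear.

(** * Split sequences *)

Lemma tau_continuousB (K : nnegCompleteFieldType) (V W : normedModType K)
    (Phi Psi : bounded_op V W -> K^o) :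
  tau_continuous Phi -> tau_continuous Psi ->
  tau_continuous (fun T => Phi T - Psi T).
Proof.
move=> [x x0 [c c0 Phic]] [y y0 [d d0 Psid]].
have [|z [z0 zD]] := @null_sequence_enum K V (fun n => [:: x n; y n]).
  move=> e e0; have /cvg_seqP/(_ e e0)[N HN] := x0.
  have /cvg_seqP/(_ e e0)[N' HN'] := y0; exists (maxn N N') => n v.
  rewrite geq_max => /andP[Nn N'n]; rewrite !inE => /orP[]/eqP->.
    by have := HN n Nn; rewrite subr0.
  by have := HN' n N'n; rewrite subr0.
exists z => //; exists (c + d) => [|T e Te]; first exact: addr_ge0.
rewrite (le_trans (ler_normB _ _))// mulrDl lerD//.
  apply: Phic => n; have [m <-] := zD n (x n) (mem_head _ _); exact: Te.
apply: Psid => n; have [|m <-] := zD n (y n); last exact: Te.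
by rewrite !inE eqxx orbT.
Qed.

Section split_sequence.
Context {K : nnegCompleteFieldType} {hK : banach_scalars K}.
Variables (Y X Z : completeNormedModType K).
Variables (i : bounded_op Y X) (q : bounded_op X Z).
Hypothesis exact_iq : short_exact i q.
Variable P : bounded_op (dual X) (dual X).
Hypothesis PP : forall f, P (P f) = P f.
Hypothesis rangeP : range P = range (adjoint q).

Let qi y : q (i y) = 0.
Proof.
have [_ _ ker] := exact_iq; have : range i (i y) by exists y.
by rewrite -ker.
Qed.

Let kerq x : q x = 0 -> exists y, i y = x.
Proof.
have [_ _ ker] := exact_iq; move=> qx; have : [set x | q x = 0] x by [].
by rewrite ker => -[y _ <-]; exists y.
Qed.

Let factor : exists2 M : K, 0 < M & forall U (f : bounded_op X U),
  (forall y, f (i y) = 0) ->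
  exists2 g : bounded_op Z U, comp_op g q = f & `|g| <= M * `|f|.
Proof.
have [_ qsurj _] := exact_iq.
have [||//|M M0 qM] := @operator_factor K X Z q.
- exact: completeNormedModType_seq_complete.
- exact: completeNormedModType_seq_complete.
exists M => // U f fi; apply: qM => x /kerq[y <-]; exact: fi.
Qed.

Let P_annihilator (f : dual X) : (forall y, f (i y) = 0) -> P f = f.
Proof.
have [M _ qM] := factor; move=> /qM[g gq _].
have : range (adjoint q) f by exists g.
by rewrite -rangeP => -[h _ <-]; exact: PP.
Qed.

Let P_vanishes f y : P f (i y) = 0.
Proof.
have : range P (P f) by exists f.
by rewrite rangeP => -[g _ <-] /=; rewrite qi bounded_op0.
Qed.

(** Hahn-Banach extensions [e phi] need not depend linearly on [phi], but two extensions differ by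
    an annihilator of Y, which [P] fixes; so [e phi - P (e phi)] does not depend on the choice and
    is linear in [phi]. *)
Let extension_operator : exists E : bounded_op (dual Y) (dual X),
  forall phi y, E phi (i y) = phi y.
Proof.
have [iemb _ _] := exact_iq; have [c c0 ext] := dual_extension iemb.
have [e He] := choice ext.
have ei phi y : e phi (i y) = phi y by rewrite -[in RHS](He phi).1.
have uniq (f g : dual X) : (forall y, f (i y) = g (i y)) -> f - P f = g - P g.
  move=> fg; have : P (f - g) = f - g.
    apply: P_annihilator => y.
    by rewrite -[LHS]/(f (i y) - g (i y)) fg subrr.
  rewrite bounded_opB => Pfg; apply/eqP; rewrite subr_eq -addrA.
  by rewrite (addrC (- P g)) Pfg addrC subrK.
have bE : (fun phi => e phi - P (e phi)) \in (@bounded_linear K (dual Y) (dual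
  X)).
  apply: bounded_linearP => [a phi psi|].
    rewrite (uniq _ (a *: e phi + e psi)).
      rewrite bounded_opD bounded_opZ scalerBr opprD addrACA //.
    move=> y; rewrite ei -[RHS]/(a *: e phi (i y) + e psi (i y)) !ei //.
  exists (c + `|P| * c) => phi; rewrite (le_trans (ler_normB _ _))//
    mulrDl lerD//.
    exact: (He phi).2.
  rewrite (le_trans (ler_norm_op _ _))// -mulrA ler_wpM2l//.
  exact: (He phi).2.
exists (BoundedOp bE) => phi y.
by rewrite -[LHS]/(e phi (i y) - P (e phi) (i y)) P_vanishes subr0 ei.
Qed.

(** * Functionals that annihilate the invariant finite rank operators *)

Section annihilating_functional.
Variables (f : nat -> dual X) (x : nat -> X).
Hypothesis sf : summable_norm f.
Hypothesis x0 : x @ \oo --> 0.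
Hypothesis fx0 : forall T : bounded_op X X,
  finite_rank T /\ T @` range i `<=` range i ->
  series (fun n => f n (T (x n))) @ \oo --> (0 : K^o).

(** A rank one operator leaves Y invariant when its range lies in Y or when it vanishes on Y. The
    first kind, used here, shows that u vanishes on Y; the second, in [fx_quotient], that u maps X
    into Y. *)
Let fx_range (kappa : dual X) y :
  series (fun n => kappa (x n) * f n (i y)) @ \oo --> (0 : K^o).
Proof.
have := fx0 (T := rank1 kappa (i y)).
rewrite (_ : (fun n => f n _) = (fun n => kappa (x n) * f n (i y))).
  apply; split; first exact: finite_rank_rank1.
  by move=> _ [_ [y' _ <-] <-]; exists (kappa (i y') *: y) => //;
    exact: bounded_opZ.
by apply/funext => n; exact: dualZ.
Qed.

Let fx_quotient (g : dual Z) w : series (fun n => g (q (x n)) * f n w) @ \oo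
  --> (0 : K^o).
Proof.
have := fx0 (T := rank1 (comp_op g q) w).
rewrite (_ : (fun n => f n _) = (fun n => g (q (x n)) * f n w)).
  apply; split; first exact: finite_rank_rank1.
  move=> _ [_ [y' _ <-] <-]; exists 0 => //.
  by rewrite /= qi !bounded_op0 scale0r.
by apply/funext => n; exact: dualZ.
Qed.

Let cvg_null_summable (V : normedModType K) (a : nat -> V) (c : nat -> K) :
  seq_complete V ->
  summable_norm a -> (exists2 M : K, 0 <= M & forall n, `|c n| <= M) ->
  exists l : V, series (fun n => c n *: a n) @ \oo --> l.
Proof.
move=> cV sa [M M0 cM]; apply: cV; apply: summable_norm_cauchy.
by apply: (summable_normM M0 _ sa) => n; rewrite normrZ ler_wpM2r.
Qed.

Let functional_bounded (kappa : dual X) :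
  exists2 M : K, 0 <= M & forall n, `|kappa (x n)| <= M.
Proof.
have [M M0 xM] := cvg_bounded_seq (cvg_bounded_op (f := kappa) x0).
by exists M => //; exact: ltW.
Qed.

Let fP_series (kappa : dual X) :
  series (fun n => kappa (x n) *: (f n - P (f n))) @ \oo --> (0 : dual X).
Proof.
have [G fG] := cvg_null_summable (@dual_seq_complete K hK X) sf
  (functional_bounded kappa).
(* [G] is u^* applied to [kappa]; it annihilates Y because u does. *)
have PG : P G = G.
  apply: P_annihilator => y.
  have := cvg_bounded_op (f := evaluation (i y)) fG; rewrite bounded_op_series.
  by move/cvg_seq_unique; apply; exact: fx_range.
rewrite -[X in _ --> X](subrr G) -{2}PG.
have := cvg_bounded_op (f := id_op _ - P) fG; rewrite bounded_op_series.
rewrite (_ : (fun n => _) = (fun n => kappa (x n) *: (f n - P (f n))))//.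
by apply/funext => n; rewrite bounded_opZ.
Qed.

Let fP_trace : approximation_property X ->
  series (fun n => (f n - P (f n)) (x n)) @ \oo --> (0 : K^o).
Proof.
move=> Xap; have sfP : summable_norm (fun n => f n - P (f n)).
  apply: summable_normM sf; first exact: (normr_ge0 (id_op _ - P)).
  by move=> n; exact: (ler_norm_op (id_op _ - P)).
have [Psi [lPsi tPsi cPsi]] := nuclear_functional (or_introl (conj sfP x0)).
have <- : Psi (id_op X) = 0; last exact: cPsi.
apply: (ap_functional_id Xap lPsi tPsi) => kappa w.
apply: (cvg_seq_unique (cPsi _)).
have := cvg_bounded_op (f := evaluation w) (fP_series kappa).
rewrite bounded_op_series (_ : (fun n => evaluation w _) =
  (fun n => (f n - P (f n)) (rank1 kappa w (x n))))//.
by apply/funext => n; exact: (esym (bounded_opZ (f n - P (f n)) _ _)).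
Qed.

Section tensor_representation.
Variable a : nat -> dual Z.
Hypothesis sa : summable_norm a.
Hypothesis aq : forall n, comp_op (a n) q = P (f n).

Let aqE n w : a n (q w) = P (f n) w.
Proof. by rewrite -aq. Qed.

(** At [z = q w] the sum is u w, because the terms with [f n - P (f n)] add up to nothing; and q u =
    0. *)
Let a_series z : exists y, series (fun n => a n z *: x n) @ \oo --> i y.
Proof.
have [_ qsurj _] := exact_iq.
have [w <-] : exists w, q w = z.
  have : [set: Z] z by [].
  by rewrite -qsurj => -[w _ <-]; exists w.
have [v xv] : exists v : X, series (fun n => a n (q w) *: x n) @ \oo --> v.
  apply: completeNormedModType_seq_complete; apply: summable_norm_cauchy.
  have [c c0 xc] := cvg_bounded_seq x0.
  have cw : 0 <= c * `|q w| by rewrite mulr_ge0 ?(ltW c0).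
  apply: (summable_normM cw _ sa) => n; rewrite normrZ mulrC -mulrA.
  by rewrite ler_pM// mulrC ler_norm_op.
have [y yv] : exists y, i y = v; last by exists y; rewrite yv.
apply: kerq; apply: dual_eq0 => g.
have := cvg_bounded_op (f := comp_op g q) xv; rewrite bounded_op_series.
move/cvg_seq_unique; apply.
have := cvg_bounded_op (f := evaluation w) (fP_series (comp_op g q)).
rewrite bounded_op_series => /(cvgB (fx_quotient g w)).
rewrite subr0 (_ : _ - _ = series (fun n => comp_op g q (a n (q w) *: x n)))//.
apply/funext => n; rewrite [RHS]/series /=.
rewrite -[LHS]/(series _ n - series _ n) /series /= -sumrB;
  apply: eq_bigr => j _.
rewrite -[X in _ - X]/(g (q (x j)) * (f j w - P (f j) w)) mulrBr opprB.
by rewrite addrC subrK -aqE !bounded_opZ; exact: mulrC.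
Qed.

Lemma quotient_trace : approximation_property (dual (dual (dual Y))) ->
  approximation_property X ->
  series (fun n => a n (q (x n))) @ \oo --> (0 : K^o).
Proof.
move=> Y3ap Xap; have [E Ei] := extension_operator.
(* The adjoint of the extension operator, restricted to X; by [Ei] it agrees with the canonical
   embedding on Y. *)
pose H := comp_op (adjoint E) (bidual X).
have Hi y : H (i y) = bidual Y y by apply: bounded_op_eq => phi; exact: Ei.
have Hx0 : (fun n => H (x n)) @ \oo --> 0.
  by rewrite -[X in _ --> X](bounded_op0 H); exact: cvg_bounded_op.
have aH z y : series (fun n => a n z *: x n) @ \oo --> i y ->
    series (fun n => a n z *: H (x n)) @ \oo --> bidual Y y.
  move=> /(cvg_bounded_op (f := H)); rewrite bounded_op_series Hi.
  rewrite (_ : (fun n => H _) = (fun n => a n z *: H (x n)))//.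
  by apply/funext => n; exact: bounded_opZ.
have nuc : bidual_nuclear a (fun n => H (x n)).
  split=> // z; have [y ay] := a_series z; exists y; exact: aH.
have [r ar] : exists r : dual (bounded_op (dual Z) (dual Y)),
    series (fun n => tensor (a n) (H (x n))) @ \oo --> r.
  apply: dual_seq_complete; apply: summable_norm_cauchy.
  have [c c0 Hc] := cvg_bounded_seq Hx0.
  apply: (summable_normM (ltW c0) _ sa) => n.
  by rewrite (le_trans (norm_tensor _ _))// mulrC ler_wpM2r.
have [s [d [d0 s1 sd sr]]] := bidual_nuclear_series Y3ap nuc ar.
have saq : summable_norm (fun n => comp_op (a n) q).
  apply: (summable_normM (normr_ge0 q) _ sa) => n.
  apply: norm_op_le => [|w]; first exact: mulr_ge0.
  rewrite (le_trans (ler_norm_op (a n) _))// [`|q| * _]mulrC -mulrA.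
  by rewrite ler_wpM2l// ler_norm_op.
have [Phi [lPhi tPhi cPhi]] := nuclear_functional (or_introl (conj saq x0)).
pose omega j (T : bounded_op X X) : K^o := \sum_(p <- s j) p.1 (q (T (i p.2))).
(* One factor 2^-n makes the vectors [i p.2], bounded by [|i|], into a null sequence; the other
   stays in the weights [|q| * d * 2^-j]. *)
have [z [z0 zD]] : exists z : nat -> X, z @ \oo --> 0 /\
    forall n v, v \in [seq 2^-1 ^+ n *: i p.2 | p <- s n] -> exists m, z m = v.
  apply: null_sequence_enum => e e0; have i1 : 0 < `|i| + 1 by rewrite ltr_wpDl.
  have /cvg_seqP/(_ _ (divr_gt0 e0 i1))[N HN] := @cvg_half K.
  exists N => n _ Nn /mapP[p ps ->]; rewrite normrZ.
  have := HN n Nn; rewrite subr0 => hn.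
  rewrite (le_trans (ler_pM _ _ hn (_ : `|i p.2| <= `|i| + 1)))//; last first.
    by rewrite divfK// gt_eqF.
  rewrite (le_trans (ler_norm_op _ _))// ler_wpDr// ler_piMr//; exact: s1 ps.
have [||||Psi [lPsi tPsi cPsi]] := @tau_continuous_series K hK X X omega z
    (fun j => `|q| * d * 2^-1 ^+ j).
- move=> j b S T; rewrite /omega scaler_sumr -big_split /=;
    apply: eq_bigr => p _.
  transitivity (p.1 (q (b *: S (i p.2) + T (i p.2)))) => //.
  by rewrite !bounded_opD !bounded_opZ.
- exact: z0.
- exists (`|q| * d * 2) => n; under eq_bigr do rewrite ger0_norm ?mulr_ge0
    ?exprn_ge0 ?invr_ge0//.
  by rewrite -mulr_sumr ler_wpM2l ?mulr_ge0// sum_half_le.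
- move=> j T e Te; rewrite [X in _ <= X * e]ger0_norm ?mulr_ge0 ?exprn_ge0
    ?invr_ge0//.
  have h0 : 0 < (2^-1 : K) ^+ j by rewrite exprn_gt0 ?invr_gt0.
  have e0 : 0 <= e by rewrite (le_trans _ (Te 0%N)).
  rewrite (le_trans (ler_norm_sum _ _ _))//.
  rewrite (@le_trans _ _ (\sum_(p <- s j) `|p.1| * (`|q| * (e / 2^-1 ^+ j))))//.
    rewrite big_seq [leRHS]big_seq; apply: ler_sum => p ps.
    rewrite (le_trans (ler_norm_op _ _))// ler_wpM2l//.
    rewrite (le_trans (ler_norm_op _ _))// ler_wpM2l//.
    have [|m zm] := zD j (2^-1 ^+ j *: i p.2); first by apply/mapP; exists p.
    have := Te m; rewrite zm bounded_opZ normrZ gtr0_norm// mulrC.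
    by rewrite ler_pdivlMr.
  rewrite -mulr_suml (le_trans (ler_wpM2r _ (sd j)))//.
    by rewrite !mulr_ge0// invr_ge0 ltW.
  rewrite le_eqVlt; apply/orP; left; apply/eqP; set g := _ ^+ j in h0 *.
  by field; rewrite gt_eqF.
(* [Phi] and [Psi] are the traces of [T] against two representations of v o q on X. On a rank one
   operator both equal the value of [r] at the rank one operator [B] below. *)
pose Theta T := Phi T - Psi T.
have lTheta : linear Theta.
  by move=> b S T; rewrite /Theta lPhi lPsi scalerBr opprD addrACA.
have : Theta (id_op X) = 0.
  apply: (ap_functional_id Xap lTheta (tau_continuousB tPhi tPsi)) => kappa w.
  have [y ay] := a_series (q w).
  have PhiE : Phi (rank1 kappa w) = kappa (i y).
    apply: (cvg_seq_unique (cPhi _)).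
    have := cvg_bounded_op (f := kappa) ay; rewrite bounded_op_series.
    rewrite (_ : (fun n => kappa _) =
      (fun n => comp_op (a n) q (rank1 kappa w (x n))))//.
    by apply/funext => n; rewrite /= !bounded_opZ; exact: mulrC.
  pose B := rank1 (evaluation (q w)) (adjoint i kappa).
  have rB : r B = kappa (i y).
    apply: (cvg_seq_unique (cvg_bounded_op (f := evaluation B) ar)).
    have := cvg_bounded_op (f := evaluation (adjoint i kappa)) (aH _ _ ay).
    rewrite !bounded_op_series (_ : (fun n => _) =
      (fun n => evaluation B (tensor (a n) (H (x n)))))//.
    by apply/funext => n; rewrite /= bounded_opZ.
  have PsiE : Psi (rank1 kappa w) = r B.
    apply: (cvg_seq_unique (cPsi _)).
    have := cvg_bounded_op (f := evaluation B) sr.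
    rewrite bounded_op_series (_ : (fun n => _) = omega ^~ (rank1 kappa w))//.
    apply/funext => j; rewrite -[LHS]/(list_tensor (s j) B) /list_tensor.
    rewrite bounded_op_sum /omega.
    by apply: eq_bigr => p _; rewrite /= !bounded_opZ; exact: mulrC.
  by rewrite /Theta PhiE PsiE rB subrr.
rewrite /Theta => /eqP; rewrite subr_eq0 => /eqP PhiPsi.
have Psi0 : Psi (id_op X) = 0.
  apply: (cvg_seq_unique (cPsi _)).
  rewrite (_ : series _ = fun=> 0); first exact: cvg_cst.
  apply/funext => n; rewrite /series /= big1// => j _;
    rewrite /omega big1// => p _.
  by rewrite /= qi bounded_op0.
by rewrite -Psi0 -PhiPsi; exact: cPhi.
Qed.

End tensor_representation.

Lemma annihilates_id :
  approximation_property (dual (dual (dual Y))) -> approximation_property X ->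
  series (fun n => f n (x n)) @ \oo --> (0 : K^o).
Proof.
move=> Y3ap Xap; have [M M0 qM] := factor.
have /choice[a Ha] n : exists g : dual Z,
    comp_op g q = P (f n) /\ `|g| <= M * `|P (f n)|.
  by have [|g] := qM _ (P (f n)); [exact: P_vanishes|exists g].
have sPf : summable_norm (fun n => P (f n)).
  by apply: (summable_normM (normr_ge0 P) _ sf) => n; exact: ler_norm_op.
have sa : summable_norm a.
  by apply: (summable_normM (ltW M0) _ sPf) => n; exact: (Ha n).2.
have aq n : comp_op (a n) q = P (f n) := (Ha n).1.
rewrite -[X in _ --> X](addr0 (0 : K^o)).
rewrite (_ : series _ = series (fun n => (f n - P (f n)) (x n)) +
    series (fun n => a n (q (x n)))).
  by apply: cvgD; [exact: fP_trace|exact: quotient_trace].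
apply/funext => n; rewrite [LHS]/series /=.
rewrite -[RHS]/(series _ n + series _ n) /series /= -big_split; apply/esym.
apply: eq_bigr => j _; rewrite /= -[a j _]/(comp_op (a j) q (x j)) aq.
exact: (subrK (P (f j) (x j))).
Qed.

End annihilating_functional.

Lemma splitting_pair_approximation :
  approximation_property (dual (dual (dual Y))) -> approximation_property X ->
  pair_approximation_property (range i).
Proof.
move=> Y3ap Xap; apply/id_is_tau_limitP; apply: tau_dense_criterion.
- split; first by apply/finite_rankP; exists [::] => v; rewrite big_nil.
  by move=> _ [_ [y _ <-] <-]; exists 0 => //; exact: bounded_op0.
- move=> b S T [Sfr SY] [Tfr TY]; split; first exact: finite_rank_linear.
  move=> _ [_ [y _ <-] <-].
  have [|y1 _ y1E] := SY (S (i y)); first by exists (i y) => //; exists y.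
  have [|y2 _ y2E] := TY (T (i y)); first by exists (i y) => //; exists y.
  exists (b *: y1 + y2) => //.
  by rewrite bounded_opD bounded_opZ y1E y2E.
- by move=> f x sf x0 fx0; exact: annihilates_id.
Qed.

End split_sequence.

(** By the open mapping theorem a null sequence of [Z] lifts to one of [X], and an operator that
    leaves the kernel of [q] invariant induces one on [Z], again of finite rank. *)
Lemma quotient_approximation_property (K : nnegCompleteFieldType)
    (Y X Z : completeNormedModType K) (i : bounded_op Y X) (q :
      bounded_op X Z) :
  short_exact i q -> pair_approximation_property (range i) ->
  approximation_property Z.
Proof.
move=> [_ qsurj ker] /id_is_tau_limitP Xap; apply/id_is_tau_limitP => z z0 e e0.
have cX := @completeNormedModType_seq_complete K X.
have cZ := @completeNormedModType_seq_complete K Z.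
have [M M0 qM] := open_mapping cX cZ qsurj.
have [N N0 qN] := operator_factor cX cZ qsurj.
have /choice[x Hx] n : exists x, q x = z n /\ `|x| <= M * `|z n|.
  by have [x] := qM (z n); exists x.
have x0 : x @ \oo --> 0.
  apply/cvg_seqP => d d0; have /cvg_seqP/(_ _ (divr_gt0 d0 M0))[n0 Hn] := z0.
  exists n0 => n nn; rewrite subr0 (le_trans (Hx n).2)// mulrC -ler_pdivlMr//.
  by have := Hn n nn; rewrite subr0.
have q1 : 0 < `|q| + 1 by rewrite ltr_wpDl.
have [T [Tfr TY] Tx] := Xap x x0 _ (divr_gt0 e0 q1).
have [|S Sq _] := qN _ (comp_op q T).
  move=> v qv; have : [set x | q x = 0] v by [].
  rewrite ker => -[y _ <-]; have [|y' _ y'E] := TY (T (i y)).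
    by exists (i y) => //; exists y.
  have : range i (T (i y)) by exists y'.
  by rewrite -ker.
have Sqx v : S (q v) = q (T v) by rewrite -[LHS]/(comp_op S q v) Sq.
exists S.
  have [n [w Tw]] := Tfr; exists n, (fun j => q (w j)) => u.
  have : [set: Z] u by [].
  rewrite -qsurj => -[v _ <-]; rewrite Sqx; have [c ->] := Tw v; exists c.
  rewrite linear_sum; apply: eq_bigr => j _; exact: bounded_opZ.
move=> n; rewrite -(Hx n).1 Sqx -bounded_opB.
rewrite (le_trans (ler_op_norm q _))// (le_trans (ler_wpM2l _ (Tx n)))//.
  exact: op_norm_ge0.
rewrite mulrCA ler_piMr ?(ltW e0)// ler_pdivrMr// mul1r.
by rewrite -[op_norm q]/(`|q|) lerDl.
Qed.

Theorem proposition1 (R : realType) (k : scalar_kind)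
    (Y X Z : completeNormedModType (scalar_field R k))
    (i : bounded_op Y X) (q : bounded_op X Z) :
  short_exact i q ->
  locally_splits q ->
  approximation_property (dual (dual (dual Y))) ->
  approximation_property X ->
  pair_approximation_property (range i) /\ approximation_property Z.
Proof.
move=> exact_iq [P [PP rangeP]] Y3ap Xap.
have hK := scalar_field_banach_scalars R k.
have pair := @splitting_pair_approximation _ hK _ _ _ i q exact_iq P PP rangeP
  Y3ap Xap.
by split=> //; exact: quotient_approximation_property exact_iq pair.
Qed.
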